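(* Let $N\ge 2$ be an integer. Let $\sigma=\{\lambda_1<\dots<\lambda_N\}$ and $\hat\sigma=\{\hat\lambda_1<\dots<\hat\lambda_N\}$ be two sets of $N$ real numbers, let $K\in\mathbb{R}$ and $n\in\{0,1,\dots,N-1\}$. Let $\mu_1,\dots,\mu_q$, $\hat N$, $\theta^2$ and $\tilde n$ be defined from these data as in the context, and assume that the following conditions I)--IV) hold. I) Put $\lambda_0=-\infty$, $\lambda_{N+1}=+\infty$ and let $p\in\{0,1,\dots,N\}$ be such that $\lambda_p<K\le\lambda_{p+1}$. Then there is exactly one element of $\hat\sigma$ in each of the following intervals: $[\lambda_j,\lambda_{j+1})$ for $j=1,\dots,p-1$; $(\lambda_j,\lambda_{j+1}]$ for $j=p+1,\dots,N-1$; $[\lambda_p,K)$ if $p\ge 1$; and $(K,\lambda_{p+1}]$ if $p\le N-1$ and this interval is not empty. II) $\theta^2=\hat N(\mu_1)=\dots=\hat N(\mu_q)\in(0,1)$ (for $q=0$ this reads $\theta^2\in(0,1)$). III) If $K\notin\sigma\cup\hat\sigma$, then $q\le\tilde n$ and $\hat N(K)=\theta^2$. IV) If $K\in\sigma\cup\hat\sigma$, then $K\in\sigma\cap\hat\sigma$ and either a) $q\le\tilde n$ and $\hat N(K)>\theta^2$, or b) $q<\tilde n$, $\hat N(K)=\theta^2$ and $\hat N'(K)=0$. Let $\mathcal{F}$ (the inverse spectral family) be the set of all pairs $(J,\tilde J)$ of $N\times N$ Jacobi matrices such that $\tilde J$ is obtained from $J$ by the perturbation at place $n$ with parameters $\theta\in(0,1)$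 (the positive square root of the given number $\theta^2$) and $M=(\theta^{-2}-1)K$, the spectrum of $J$ is $\sigma$ and the spectrum of $\tilde J$ is $\hat\sigma$. 1) If $K\notin\sigma\cup\hat\sigma$, or if $K\in\sigma\cup\hat\sigma$ and option IV a) happens, then: for $q\neq 0$ the family $\mathcal{F}$ is infinite, and it is a collection of $$\binom{N-2q-1}{n-q}$$ disjoint manifolds of dimension $q$, each diffeomorphic to a $q$-dimensional open ball; for $q=0$ the family $\mathcal{F}$ is finite and consists of exactly $\binom{N-1}{n}$ pairs. 2) If $K\in\sigma\cup\hat\sigma$ and option IV b) happens, then $\mathcal{F}$ is infinite, and it is a collection of $$\binom{N-2q-3}{n-q-1}$$ disjoint manifolds of dimension $q+1$, each diffeomorphic to a $(q+1)$-dimensional open ball.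
   Context: An $N\times N$ Jacobi matrix is a real symmetric tridiagonal matrix with diagonal entries $a_0,\dots,a_{N-1}\in\mathbb{R}$ and off-diagonal entries $b_0,\dots,b_{N-2}$ ($b_i$ in positions $(i,i+1)$ and $(i+1,i)$, rows and columns being indexed by $0,\dots,N-1$); throughout, the off-diagonal entries are negative, $b_i<0$. A pair $(J,\tilde J)$ is identified with the point of Euclidean space given by the entries of the two matrices, and the manifolds in the claim are submanifolds of this Euclidean space. Perturbation at place $n$: for $\theta\in(0,1)$ and $M\in\mathbb{R}$, the matrix $\tilde J$ has the same entries as $J$ except that $$\tilde a_n=\theta^2(a_n+M),\qquad \tilde b_{n-1}=\theta b_{n-1},\qquad \tilde b_n=\theta b_n,$$ where the equality for $\tilde b_{n-1}$ is omitted when $n=0$ and the equality for $\tilde b_n$ is omitted when $n=N-1$. Notation attached to the data $(\sigma,\hat\sigma,K,n)$: - $\{\mu_1,\dots,\mu_q\}:=(\sigma\cap\hat\sigma)\setminus\{K\}$, a set of $q$ elements ($q:=0$ if this set is empty). - $\hat N(\lambda):=\dfrac{\prod_{j=1}^N(\lambda-\hat\lambda_j)}{\prod_{j=1}^N(\lambda-\lambda_j)}$, considered as a rational function after cancellation of common factors (so it is defined at points of $\sigma\cap\hat\sigma$). - If $q\ge 1$, then $\theta^2:=\hat N(\mu_1)$. If $q=0$, then $\theta^2$ is an arbitrarily chosen number in $(0,\hat N(K)]$, fixed once and for all as part of the data (in this case it is understood that $\hat N(K)$ is finite and positive). - $\tilde n:=\min(n,N-n-1)$. *)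

(* Defs.v *)
From HB Require Import structures.
From mathcomp Require Import all_boot all_order all_algebra.
From mathcomp Require Import all_classical all_reals all_analysis.
Set Implicit Arguments.
Unset Strict Implicit.
Unset Printing Implicit Defensive.
Import Order.TTheory GRing.Theory Num.Theory.
Import numFieldNormedType.Exports.
Local Open Scope classical_set_scope.
Local Open Scope ring_scope.

(** Smooth maps between subsets of finite-dimensional normed spaces, and
    embedded submanifolds, in the sense of Milnor, Topology from the
    Differentiable Viewpoint, section 1. *)

Section Manifolds.
Context {R : realType}.

(* Meant for [U] open: [f] is of class C^k on [U]. *)
Fixpoint Ck (E F : normedModType R) (k : nat) (U : set E) (f : E -> F) : Prop :=
  if k is k'.+1 then
    (forall x, U x -> differentiable f x) /\ (forall v, Ck k' U ('D_v f))
  else forall x, U x -> {for x, continuous f}.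

(* [f] is C^oo on an arbitrary subset [X]: around each point of [X] it agrees
   on [X] with a C^oo map defined on an open set. Values of [f] outside [X] are
   irrelevant. *)
Definition smooth_on (E F : normedModType R) (X : set E) (f : E -> F) : Prop :=
  forall x, X x -> exists (U : set E) (g : E -> F),
    [/\ open U, U x, forall k, Ck k U g & forall y, (X `&` U) y -> f y = g y].

Definition diffeomorphic (E F : normedModType R) (X : set E) (Y : set F) : Prop :=
  exists (f : E -> F) (g : F -> E),
    [/\ smooth_on X f, smooth_on Y g,
        forall x, X x -> Y (f x) /\ g (f x) = x
      & forall y, Y y -> X (g y) /\ f (g y) = y].

Definition submanifold (E : normedModType R) (d : nat) (S : set E) : Prop :=
  forall x, S x -> exists (W : set E) (V : set 'rV[R]_d),
    [/\ open W, W x, open V & diffeomorphic (S `&` W) V].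

(* The norm of the library on ['rV[R]_d] is the sup norm, hence the explicit
   Euclidean ball. *)
Definition open_unit_ball (d : nat) : set 'rV[R]_d :=
  [set x | \sum_i x 0 i ^+ 2 < 1].

Definition disjoint_union_of_balls (E : normedModType R) (d k : nat)
    (S : set E) : Prop :=
  exists C : 'I_k -> set E,
    [/\ forall i, submanifold d (C i),
        forall i, diffeomorphic (C i) (@open_unit_ball d),
        forall i j, i != j -> C i `&` C j = set0
      & S = \bigcup_i C i].

End Manifolds.

Section Jacobi.
Context {R : realType} {N : nat}.

Definition jacobi (J : 'M[R]_N) : Prop :=
  [/\ J^T = J,
      forall i j : 'I_N, (i.+1 < j)%N -> J i j = 0
    & forall i j : 'I_N, j = i.+1 :> nat -> J i j < 0].

(* On a tridiagonal [J], the entries of row and column [n] off the diagonal are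
   b_(n-1) and b_n (when they exist) and zeros. *)
Definition perturbation (n : 'I_N) (theta M : R) (J : 'M[R]_N) : 'M[R]_N :=
  \matrix_(i, j)
    if (i == n) && (j == n) then theta ^+ 2 * (J n n + M)
    else if (i == n) || (j == n) then theta * J i j
    else J i j.

Definition spectrum (J : 'M[R]_N) : set R := [set x | eigenvalue J x].

End Jacobi.

(** Spectra are given as increasingly sorted [N]-tuples; [sigma] and [sigmah]
    stand for sigma and sigma-hat. *)

Section SpectralData.
Context {R : realType} {N : nat}.
Implicit Types (sigma sigmah : N.-tuple R) (K thetasq : R) (n : 'I_N).

(* lambda_j, numbered from 1, with lambda_0 = -oo and lambda_(N+1) = +oo. *)
Definition lam sigma (j : nat) : \bar R :=
  if j == 0%N then -oo%E
  else if (j <= N)%N then (sigma`_j.-1)%:E else +oo%E.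

Definition unique_in sigmah (I : interval (\bar R)) : Prop :=
  count (fun x => x%:E \in I) sigmah = 1%N.

Definition mus sigma sigmah K : seq R :=
  [seq x <- sigma | (x \in sigmah) && (x != K)].

Definition qnum sigma sigmah K : nat := size (mus sigma sigmah K).

Definition spec_poly sigma : {poly R} := \prod_(x <- sigma) ('X - x%:P).

(* Numerator and denominator of N-hat after cancellation of common factors. *)
Definition Nhat_num sigma sigmah : {poly R} :=
  spec_poly sigmah %/ gcdp (spec_poly sigmah) (spec_poly sigma).

Definition Nhat_den sigma sigmah : {poly R} :=
  spec_poly sigma %/ gcdp (spec_poly sigmah) (spec_poly sigma).

Definition Nhat sigma sigmah (x : R) : R :=
  (Nhat_num sigma sigmah).[x] / (Nhat_den sigma sigmah).[x].

(* For q = 0 the nonvanishing of the denominator says that N-hat(K) is finite. *)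
Definition thetasq_spec sigma sigmah K thetasq : Prop :=
  if qnum sigma sigmah K == 0%N then
    (Nhat_den sigma sigmah).[K] != 0 /\ 0 < thetasq <= Nhat sigma sigmah K
  else thetasq = Nhat sigma sigmah (mus sigma sigmah K)`_0.

Definition ntilde n : nat := minn n (N - n - 1).

Definition condI sigma sigmah K (p : nat) : Prop :=
  [/\ forall j, (1 <= j <= p - 1)%N ->
        unique_in sigmah `[lam sigma j, lam sigma j.+1[,
      forall j, (p + 1 <= j <= N - 1)%N ->
        unique_in sigmah `]lam sigma j, lam sigma j.+1],
      (1 <= p)%N -> unique_in sigmah `[lam sigma p, K%:E[
    & (p <= N - 1)%N -> (K%:E < lam sigma p.+1)%E ->
        unique_in sigmah `]K%:E, lam sigma p.+1] ].

Definition condII sigma sigmah K thetasq : Prop :=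
  (forall mu, mu \in mus sigma sigmah K -> thetasq = Nhat sigma sigmah mu)
  /\ 0 < thetasq < 1.

Definition condIII sigma sigmah K n thetasq : Prop :=
  ~~ ((K \in sigma) || (K \in sigmah)) ->
  (qnum sigma sigmah K <= ntilde n)%N /\ Nhat sigma sigmah K = thetasq.

Definition optionIVa sigma sigmah K n thetasq : Prop :=
  (qnum sigma sigmah K <= ntilde n)%N /\ thetasq < Nhat sigma sigmah K.

Definition optionIVb sigma sigmah K n thetasq : Prop :=
  [/\ (qnum sigma sigmah K < ntilde n)%N,
      Nhat sigma sigmah K = thetasq
    & derive1 (Nhat sigma sigmah) K = 0].

Definition condIV sigma sigmah K n thetasq : Prop :=
  (K \in sigma) || (K \in sigmah) ->
  (K \in sigma) && (K \in sigmah) /\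
  (optionIVa sigma sigmah K n thetasq \/ optionIVb sigma sigmah K n thetasq).

Definition inverse_family sigma sigmah K n thetasq :
    set ('M[R]_N * 'M[R]_N)%type :=
  [set JJ | let theta := Num.sqrt thetasq in
    [/\ jacobi JJ.1 /\ jacobi JJ.2,
        JJ.2 = perturbation n theta ((theta ^- 2 - 1) * K) JJ.1,
        spectrum JJ.1 = [set x | x \in sigma]
      & spectrum JJ.2 = [set x | x \in sigmah]]].

End SpectralData.

(* Main.v *)
(** Let [p_l], [p_r] be the characteristic polynomials of the blocks of [J] to
    the left and to the right of site [n], and [s_l / p_l], [s_r / p_r] the
    J-fractions of these blocks expanded outwards from [n]. Then
    [P := char_poly J = (X - a_n) p_l p_r - s_l p_r - p_l s_r], and the
    perturbation multiplies [s_l] and [s_r] by [theta ^ 2], so that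
    [char_poly J~ = theta^2 P + (1 - theta^2) (X - K) p_l p_r].
    Prescribing the two spectra thus means prescribing [P] and [Q := p_l p_r].

    Conditions I)-IV) say that [Q / P] has nonnegative residues, and that the
    common zeros of [P] and [Q] (the [mu_i], and [K] in case IV b)) are double
    zeros of [Q]. Hence [P / Q = X - a0 - \sum_i c_i / (X - xi_i)] with
    [c_i > 0], the sum being over the distinct zeros of [Q].

    A block is determined by its eigenvalues and by the residues of [s / p] at
    them, which can be any positive numbers: the block is recovered from the
    orthogonal polynomials of the corresponding discrete measure. Each simple
    zero of [Q] is an eigenvalue of exactly one block, which may be chosen
    freely subject to the sizes of the blocks (whence the binomial coefficient)
    and receives the whole of [c_i]. Each double zero is an eigenvalue of both
    blocks, and its [c_i] is shared as [t c_i + (1 - t) c_i] with an arbitrary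
    [t] in (0, 1). So every choice gives an open box of parameters. The block
    entries are smooth functions of [t], and [t] is a polynomial in the entries
    of [J] because the nodes are fixed. *)
Require Import Defs.
From HB Require Import structures.
From mathcomp Require Import all_boot all_order all_algebra.
From mathcomp Require Import all_classical all_reals all_analysis.
From mathcomp Require Import ring lra zify.
Set Implicit Arguments.
Unset Strict Implicit.
Unset Printing Implicit Defensive.
Import Order.TTheory GRing.Theory Num.Theory.
Import numFieldNormedType.Exports.
Local Open Scope ring_scope.

(** * J-fractions *)

Section JFractions.
Variable R : realFieldType.
Implicit Types (l r : seq (R * R)) (a : R).

(* For [l = [:: (a0, b0); (a1, b1); ...]], the denominator and the numerator of
   the continued fraction [b0 / (X - a0 - b1 / (X - a1 - ...))]. *)
Fixpoint jfrac l : {poly R} * {poly R} :=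
  if l is (a, b) :: l' then
    (('X - a%:P) * (jfrac l').1 - (jfrac l').2, b%:P * (jfrac l').1)
  else (1, 0).

Definition jden l := (jfrac l).1.
Definition jnum l := (jfrac l).2.

Lemma jden_cons x l : jden (x :: l) = ('X - x.1%:P) * jden l - jnum l.
Proof. by case: x. Qed.

Lemma jnum_cons x l : jnum (x :: l) = x.2%:P * jden l.
Proof. by case: x. Qed.

Lemma jfrac_size l :
  [/\ jden l \is monic, size (jden l) = (size l).+1
    & (size (jnum l) <= size l)%N].
Proof.
elim: l => [|x l [mon sz szn]].
  by rewrite /jden /jnum /= monic1 size_poly1 size_poly0.
rewrite jden_cons jnum_cons.
have monM : ('X - x.1%:P) * jden l \is monic by rewrite monicMl ?monicXsubC.
have szM : size (('X - x.1%:P) * jden l) = (size l).+2.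
  by rewrite size_monicM ?monicXsubC ?monic_neq0// size_XsubC sz addnS.
have lt : (size (- jnum l) < size (('X - x.1%:P)%R * jden l)%R)%N.
  by rewrite szM size_polyN ltnS ltnW.
split.
- by rewrite monicE lead_coefDl// -monicE.
- by rewrite size_polyDl.
- by rewrite mul_polyC (leq_trans (size_scale_leq _ _))// sz.
Qed.

Lemma jden_monic l : jden l \is monic.
Proof. by case: (jfrac_size l). Qed.

Lemma size_jden l : size (jden l) = (size l).+1.
Proof. by case: (jfrac_size l). Qed.

Lemma size_jnum l : (size (jnum l) <= size l)%N.
Proof. by case: (jfrac_size l). Qed.

(** Equals [- p ^+ 2] times the derivative of [q / p]. *)
Definition wronskian (p q : {poly R}) := p^`() * q - p * q^`().

(** Prepending [(a, b)] turns the Wronskian [w] of the tail into [b * (jden l ^+ 2 + w)], so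
    positivity is inherited from the tail. The empty list has Wronskian 0, and there the square,
    equal to 1, takes over. *)
Lemma jfrac_wronskian_gt0 l x :
  all (fun y => 0 < y.2) l -> l != [::] ->
  0 < (wronskian (jden l) (jnum l)).[x].
Proof.
elim: l => // y l IHl /= /andP[y0 l0] _.
have -> : wronskian (jden (y :: l)) (jnum (y :: l)) =
  y.2%:P * (jden l ^+ 2 + wronskian (jden l) (jnum l)).
  rewrite jden_cons jnum_cons /wronskian !poly.derivE; ring.
rewrite hornerM hornerC mulr_gt0// hornerD horner_exp.
case: l IHl l0 => [|z l] IHl l0.
  rewrite /wronskian /jden /jnum /= mulr0 deriv0 mulr0 subrr !hornerE /=; lra.
by rewrite ltr_wpDl ?sqr_ge0// IHl.
Qed.

(** The coefficients are read off one site at a time: the leading coefficient of the numerator gives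
    [b], which exposes the denominator of the tail; two different [a] would then force a nonzero
    multiple of that denominator to have too small a degree. *)
Lemma jfrac_inj l r :
  all (fun y => 0 < y.2) l -> all (fun y => 0 < y.2) r -> size l = size r ->
  jden l = jden r -> jnum l = jnum r -> l = r.
Proof.
elim: l r => [|[a b] l IHl] [|[a' b'] r]//= /andP[b0 l0] /andP[b'0 r0] [sz].
rewrite !jden_cons !jnum_cons /= => eden enum.
have eb : b = b'.
  have /(congr1 lead_coef) := enum.
  rewrite !lead_coefM !lead_coefC (eqP (jden_monic l)) (eqP (jden_monic r)).
  by rewrite !mulr1.
rewrite -eb in enum *; clear b'0 eb b'.
have elr : jden l = jden r.
  by apply: (mulfI _ enum); rewrite polyC_eq0 gt_eqF.
rewrite -elr in eden.
have e1 : (a' - a)%:P * jden l = jnum l - jnum r.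
  rewrite polyCB; apply/eqP; rewrite -subr_eq0; apply/eqP.
  transitivity ((('X - a%:P) * jden l - jnum l) - (('X - a'%:P) * jden l - jnum r)).
    by ring.
  by rewrite eden subrr.
have ea : a = a'.
  apply/eqP; apply: contraT => ne.
  have : (size ((a' - a)%:P * jden l)%R <= size l)%N.
    rewrite e1 (leq_trans (size_polyD _ _))// size_polyN geq_max size_jnum.
    by rewrite sz size_jnum.
  by rewrite mul_polyC size_scale ?subr_eq0 1?eq_sym// size_jden ltnn.
rewrite -ea in e1 *; congr cons; apply: IHl => //.
by apply/eqP; rewrite -subr_eq0 -e1 subrr mul0r.
Qed.

(** [jfrac] grows at the front; growth at the far end obeys the three-term recurrence of orthogonal
    polynomials. *)
Lemma jfrac_rcons2 l x y :
  jden (rcons (rcons l x) y) =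
    ('X - y.1%:P) * jden (rcons l x) - y.2%:P * jden l /\
  jnum (rcons (rcons l x) y) =
    ('X - y.1%:P) * jnum (rcons l x) - y.2%:P * jnum l.
Proof.
elim: l => [|z l [IHd IHn]].
  rewrite /= !(jden_cons, jnum_cons) /jden /jnum /=; split; ring.
rewrite !rcons_cons !(jden_cons z, jnum_cons z) IHd IHn; split; ring.
Qed.

(* The characteristic polynomial of a Jacobi matrix with [a] at some site, [l]
   and [r] being the two halves listed outwards from that site. *)
Definition two_sided l a r :=
  ('X - a%:P) * (jden l * jden r) - jnum l * jden r - jden l * jnum r.

(** Lets the distinguished site travel along the chain: the coupling between the old and the new
    center changes lists. *)
Lemma two_sided_shift a b l a' r :
  two_sided ((a, b) :: l) a' r = two_sided l a ((a', b) :: r).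
Proof. rewrite /two_sided !(jden_cons, jnum_cons) /=; ring. Qed.

End JFractions.

(** * Partial fractions over finitely many distinct nodes *)

Section PartialFractions.
Variable R : realFieldType.

Lemma div_gt0_mul (a b : R) : b != 0 -> (0 < a / b) = (0 < a * b).
Proof.
move=> b0; have b2 : 0 < b ^+ 2 by rewrite lt_def sqr_ge0 sqrf_eq0 b0.
by rewrite -(pmulr_lgt0 (a / b) b2) expr2 mulrA divfK.
Qed.

(** Multiplying [p - q] by the product over the exceptional points gives a polynomial that vanishes
    everywhere, hence the zero polynomial. *)
Lemma poly_eq_off (s : seq R) (p q : {poly R}) :
  (forall x, x \notin s -> p.[x] = q.[x]) -> p = q.
Proof.
move=> epq; apply/eqP; rewrite -subr_eq0; apply: contraT => ne0.
pose d := (p - q) * \prod_(z <- s) ('X - z%:P).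
have d0 : d != 0 by rewrite mulf_neq0// monic_neq0// monic_prod_XsubC.
have := @max_poly_roots _ d [seq i%:R | i <- iota 0 (size d)] d0.
rewrite size_map size_iota ltnn; apply => //; last first.
  by rewrite map_inj_uniq ?iota_uniq// => i j /eqP; rewrite eqr_nat => /eqP.
apply/allP => x _; rewrite rootM root_prod_XsubC.
have [xs|xs] := boolP (x \in s); first by rewrite orbT.
by rewrite orbF rootE hornerD hornerN epq// subrr.
Qed.

Lemma size_polyB_lt (p q : {poly R}) : size p = size q ->
  lead_coef p = lead_coef q -> p != 0 -> (size (p - q)%R < size p)%N.
Proof.
move=> sz; rewrite /lead_coef -sz -size_poly_gt0.
case e: (size p) => [//|m] /= lc _; rewrite ltnS; apply/leq_sizeP => j.
rewrite coefB leq_eqVlt => /predU1P[<-|mj]; first by rewrite lc subrr.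
by rewrite !nth_default ?subrr// -?sz e.
Qed.

Variables (I : finType) (xi : I -> R).
Hypothesis xi_inj : injective xi.
Implicit Types (A : {set I}) (w : I -> R) (i : I).

Definition nodal A : {poly R} := \prod_(i in A) ('X - (xi i)%:P).
Definition cofactor_at A i : {poly R} := \prod_(j in A | j != i) ('X - (xi j)%:P).
(** The numerator of [\sum_(i in A) w i / (X - xi i)] over the denominator [nodal A]. *)
Definition nodal_num A w : {poly R} := \sum_(i in A) (w i)%:P * cofactor_at A i.

Lemma nodal_monic A : nodal A \is monic.
Proof. by apply: monic_prod => i _; apply: monicXsubC. Qed.

Lemma size_nodal A : size (nodal A) = #|A|.+1.
Proof. by rewrite /nodal -big_enum size_prod_XsubC cardE. Qed.

Lemma nodalE A i : i \in A -> nodal A = ('X - (xi i)%:P) * cofactor_at A i.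
Proof. by move=> iA; rewrite /nodal (bigD1 i). Qed.

Lemma horner_nodal A x : (nodal A).[x] = \prod_(i in A) (x - xi i).
Proof. by rewrite horner_prod; apply: eq_bigr => i _; rewrite !hornerE. Qed.

Lemma root_nodal A x : root (nodal A) x = [exists i in A, x == xi i].
Proof.
rewrite rootE horner_nodal; apply/eqP/exists_inP => [/eqP|[i iA /eqP->]].
  by move/prodf_eq0 => [i iA]; rewrite subr_eq0; exists i.
by rewrite (bigD1 i)//= subrr mul0r.
Qed.

Lemma root_nodal_xi A i : root (nodal A) (xi i) = (i \in A).
Proof.
rewrite root_nodal; apply/exists_inP/idP => [[j jA /eqP/xi_inj->]//|iA].
by exists i.
Qed.

Lemma cofactor_at_neq0 A i : (cofactor_at A i).[xi i] != 0.
Proof.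
rewrite horner_prod; apply/prodf_neq0 => j /andP[_ ji].
by rewrite !hornerE subr_eq0; apply: contra ji => /eqP/xi_inj->.
Qed.

Lemma cofactor_at_eq0 A i j : i \in A -> i != j -> (cofactor_at A j).[xi i] = 0.
Proof.
by move=> iA ij; rewrite horner_prod (bigD1 i) ?iA//= !hornerE subrr mul0r.
Qed.

Lemma size_cofactor_at A i : i \in A -> size (cofactor_at A i) = #|A|.
Proof.
move=> iA; have := size_nodal A; rewrite (nodalE iA) size_monicM ?monicXsubC//.
  by rewrite size_XsubC => -[].
by apply: contraTneq (cofactor_at_neq0 A i) => ->; rewrite horner0 eqxx.
Qed.

Lemma horner_deriv_nodal A i : i \in A ->
  (nodal A)^`().[xi i] = (cofactor_at A i).[xi i].
Proof.
move=> iA; rewrite (nodalE iA) derivM !poly.derivE !hornerE; ring.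
Qed.

Lemma horner_nodal_num A w i : i \in A ->
  (nodal_num A w).[xi i] = w i * (cofactor_at A i).[xi i].
Proof.
move=> iA; rewrite horner_sum (bigD1 i)//= big1 ?addr0 ?hornerM ?hornerC//.
move=> j /andP[jA ji].
by rewrite hornerM cofactor_at_eq0 ?mulr0// eq_sym.
Qed.

Lemma size_nodal_num A w : (size (nodal_num A w) <= #|A|)%N.
Proof.
apply: (leq_trans (size_sum _ _ _)); apply/bigmax_leqP => i iA.
by rewrite mul_polyC (leq_trans (size_scale_leq _ _))// size_cofactor_at.
Qed.

(** Lagrange interpolation: the difference of the two sides has size at most [#|A|] and vanishes at
    [#|A|] distinct nodes. *)
Lemma nodal_numE A (p : {poly R}) : (size p <= #|A|)%N ->
  p = nodal_num A (fun i => p.[xi i] / (cofactor_at A i).[xi i]).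
Proof.
move=> szp; apply/eqP; rewrite -subr_eq0; apply: contraT => ne0.
set q := nodal_num _ _ in ne0 *.
suff : (size [seq xi i | i in A] < size (p - q)%R)%N.
  rewrite size_map -cardE ltnNge (leq_trans (size_polyD _ _))// size_polyN.
  by rewrite geq_max szp size_nodal_num.
apply: max_poly_roots => //; last first.
  by rewrite map_inj_uniq ?enum_uniq.
apply/allP => x /mapP[i]; rewrite mem_enum => iA ->.
rewrite rootE hornerD hornerN horner_nodal_num// divfK ?subrr//.
exact: cofactor_at_neq0.
Qed.

Lemma nodal_num_inj A w w' : nodal_num A w = nodal_num A w' ->
  {in A, w =1 w'}.
Proof.
move=> e i iA; have := congr1 (horner^~ (xi i)) e.
by rewrite /= !horner_nodal_num// => /(mulIf (cofactor_at_neq0 A i)).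
Qed.

Lemma eq_nodal_num A w w' : {in A, w =1 w'} -> nodal_num A w = nodal_num A w'.
Proof. by move=> e; apply: eq_bigr => i iA; rewrite e. Qed.

Lemma horner_nodal_num_off A w x : (forall i, i \in A -> x != xi i) ->
  (nodal_num A w).[x] = (nodal A).[x] * \sum_(i in A) w i / (x - xi i).
Proof.
move=> xA; rewrite horner_sum mulr_sumr; apply: eq_bigr => i iA.
rewrite (nodalE iA) !hornerE /=; field.
by rewrite subr_eq0 xA.
Qed.

(** The Wronskian is [\sum_(i in A) w i * cofactor_at A i ^+ 2]. At a node its own cofactor is
    nonzero, and elsewhere every cofactor is. *)
Lemma nodal_num_wronskian A w x : (forall i, i \in A -> 0 < w i) -> (0 < #|A|)%N ->
  0 < (wronskian (nodal A) (nodal_num A w)).[x].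
Proof.
move=> w0 /card_gt0P[i0 i0A].
have -> : wronskian (nodal A) (nodal_num A w) =
    \sum_(i in A) (w i)%:P * cofactor_at A i ^+ 2.
  rewrite /wronskian /nodal_num (raddf_sum (@deriv R)) !mulr_sumr -sumrB; apply: eq_bigr.
  move=> i iA; rewrite (nodalE iA) /= !poly.derivE; ring.
rewrite horner_sum.
have [i iA xi_i] : exists2 i, i \in A & (cofactor_at A i).[x] != 0.
  case: (boolP [exists i in A, x == xi i]) => [/exists_inP[i iA /eqP->]|].
    by exists i => //; apply: cofactor_at_neq0.
  rewrite negb_exists_in => /forall_inP xA; exists i0 => //.
  rewrite horner_prod; apply/prodf_neq0 => j /andP[jA _].
  by rewrite !hornerE subr_eq0 xA.
rewrite (bigD1 i)//= ltr_wpDr//.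
  apply: sumr_ge0 => j /andP[jA _]; rewrite hornerM hornerC horner_exp.
  by rewrite mulr_ge0 ?sqr_ge0// ltW ?w0.
by rewrite hornerM hornerC horner_exp mulr_gt0 ?w0// lt_def sqr_ge0 sqrf_eq0 xi_i.
Qed.

End PartialFractions.

(** * Orthogonal polynomials *)

Section OrthogonalPolynomials.
Variables (R : realFieldType) (I : finType) (xi : I -> R) (A : {set I}).
Variable w : I -> R.
Implicit Types f g h : {poly R}.

Definition wdot (f g : {poly R}) := \sum_(i in A) w i * (f.[xi i] * g.[xi i]).

(* The state is (p_k, p_(k-1), <p_(k-1), p_(k-1)>), where the convention
   <p_(-1), p_(-1)> = 1 makes the first beta equal to the total weight. *)
Fixpoint orth_state k : {poly R} * {poly R} * R :=
  if k is k'.+1 then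
    let: (p, p', h') := orth_state k' in
    let h := wdot p p in
    (('X - (wdot ('X * p) p / h)%:P) * p - (h / h')%:P * p', p, h)
  else (1, 0, 1).

Definition orth k := (orth_state k).1.1.
(** The recurrence coefficients of the Stieltjes procedure, arranged by [jcoefs] as the sites of a
    Jacobi block. *)
Definition jalpha k := wdot ('X * orth k) (orth k) / wdot (orth k) (orth k).
Definition jbeta k := wdot (orth k) (orth k) / (orth_state k).2.
Definition jcoefs m := mkseq (fun k => (jalpha k, jbeta k)) m.

Lemma orth1 : orth 1 = 'X - (jalpha 0)%:P.
Proof. by rewrite /jalpha /orth /= !(mulr0, subr0, mulr1). Qed.

Lemma orthSS k : orth k.+2 =
  ('X - (jalpha k.+1)%:P) * orth k.+1 - (jbeta k.+1)%:P * orth k.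
Proof. by rewrite /jalpha /jbeta /orth /=; case: (orth_state k) => -[]. Qed.

Lemma jbeta0 : jbeta 0 = wdot 1 1.
Proof. by rewrite /jbeta /= divr1. Qed.

Lemma jbetaS k : jbeta k.+1 = wdot (orth k.+1) (orth k.+1) / wdot (orth k) (orth k).
Proof. by rewrite /jbeta /orth /=; case: (orth_state k) => -[]. Qed.

Lemma jcoefsS m : jcoefs m.+1 = rcons (jcoefs m) (jalpha m, jbeta m).
Proof. exact: mkseqS. Qed.

(** The denominators of the truncations satisfy the recurrence of [orth]; since it reaches two steps
    back, the induction carries two consecutive indices. *)
Lemma jden_jcoefs k : jden (jcoefs k) = orth k.
Proof.
suff : jden (jcoefs k) = orth k /\ jden (jcoefs k.+1) = orth k.+1 by case.
elim: k => [|k [IH0 IH1]].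
  by rewrite orth1 /jden /= mulr1 subr0.
split => //; rewrite orthSS -IH0 -IH1 !jcoefsS.
by rewrite (jfrac_rcons2 _ _ _).1.
Qed.

Lemma orth_monic k : orth k \is monic.
Proof. by rewrite -jden_jcoefs jden_monic. Qed.

Lemma size_orth k : size (orth k) = k.+1.
Proof. by rewrite -jden_jcoefs size_jden size_mkseq. Qed.

Lemma wdotC f g : wdot f g = wdot g f.
Proof. by apply: eq_bigr => i _; rewrite [f.[_] * _]mulrC. Qed.

Lemma wdotDl f g h : wdot (f + g) h = wdot f h + wdot g h.
Proof.
by rewrite -big_split; apply: eq_bigr => i _; rewrite hornerD /=; ring.
Qed.

Lemma wdotCl c g h : wdot (c%:P * g) h = c * wdot g h.
Proof.
by rewrite mulr_sumr; apply: eq_bigr => i _; rewrite hornerM hornerC; ring.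
Qed.

Lemma wdotBl f g h : wdot (f - g) h = wdot f h - wdot g h.
Proof.
rewrite wdotDl -mulN1r -[- (1) : {poly R}]/(- 1%:P) -polyCN wdotCl.
by rewrite mulN1r.
Qed.

Lemma wdotX f g : wdot ('X * f) g = wdot f ('X * g).
Proof. apply: eq_bigr => i _; rewrite !hornerE /=; ring. Qed.

Hypothesis xi_inj : injective xi.
Hypothesis w_gt0 : forall i, i \in A -> 0 < w i.

Lemma wdot_gt0 f : f != 0 -> (size f <= #|A|)%N -> 0 < wdot f f.
Proof.
move=> f0 szf; rewrite lt_def; apply/andP; split; last first.
  by apply: sumr_ge0 => i iA; rewrite mulr_ge0 -?expr2 ?sqr_ge0// ltW ?w_gt0.
apply: contra f0 => /eqP e.
rewrite (nodal_numE xi_inj szf) /nodal_num big1// => i iA.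
suff -> : f.[xi i] = 0 by rewrite mul0r polyC0 mul0r.
have ge0 j : j \in A -> 0 <= w j * (f.[xi j] * f.[xi j]).
  by move=> jA; rewrite mulr_ge0 -?expr2 ?sqr_ge0// ltW ?w_gt0.
have /eqP := psumr_eq0P ge0 e iA.
rewrite !mulf_eq0 gt_eqF ?w_gt0//= orbb.
by move/eqP.
Qed.

Lemma orth_norm_gt0 k : (k < #|A|)%N -> 0 < wdot (orth k) (orth k).
Proof.
by move=> kA; rewrite wdot_gt0 ?size_orth// monic_neq0// orth_monic.
Qed.

Lemma X_orth k : 'X * orth k.+1 =
  orth k.+2 + (jalpha k.+1)%:P * orth k.+1 + (jbeta k.+1)%:P * orth k.
Proof. rewrite orthSS; ring. Qed.

Lemma X_orth0 : 'X * orth 0 = orth 1 + (jalpha 0)%:P * orth 0.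
Proof. rewrite orth1 /orth /=; ring. Qed.

(** Write [orth k.+2] by its recurrence. Against [orth k.+1] the choice of [jalpha] cancels the
    terms; against [orth k], once [X] is moved to the other side, the choice of [jbeta] does; for
    smaller [j], [X * orth j] involves only [orth] of index below [k.+1]. *)
Lemma orth_orthogonal k j : (j < k)%N -> (k <= #|A|)%N ->
  wdot (orth k) (orth j) = 0.
Proof.
elim/ltn_ind: k j => -[|k] IH j //; rewrite ltnS => jk kA.
have hk := orth_norm_gt0 kA.
have hj i : (i <= k)%N -> 0 < wdot (orth i) (orth i).
  by move=> ik; apply: orth_norm_gt0; apply: leq_ltn_trans kA.
have IHs i i' : (i <= k)%N -> (i' <= k)%N -> i != i' ->
    wdot (orth i) (orth i') = 0.
  move=> ik ik'; rewrite neq_ltn => /orP[] lt.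
    by rewrite wdotC IH// (leq_trans ik' (ltnW kA)).
  by rewrite IH// (leq_trans ik (ltnW kA)).
have alphaE i : (i <= k)%N ->
    wdot ('X * orth i) (orth i) = jalpha i * wdot (orth i) (orth i).
  by move=> ik; rewrite /jalpha divfK// gt_eqF ?hj.
case: k IH jk kA hk hj IHs alphaE => [|k] IH jk kA hk hj IHs alphaE.
  move: jk; rewrite leqn0 => /eqP ->.
  by rewrite -[orth 1](addrK ((jalpha 0)%:P * orth 0)) -X_orth0 wdotBl wdotCl
     alphaE// subrr.
rewrite orthSS mulrBl 2!wdotBl wdotCl wdotCl.
have betaE : jbeta k.+1 * wdot (orth k) (orth k) = wdot (orth k.+1) (orth k.+1).
  by rewrite jbetaS divfK// gt_eqF ?hj.
move: jk; rewrite leq_eqVlt => /predU1P[->|]; rewrite ?ltnS.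
  by rewrite alphaE// [wdot (orth k) _]IHs ?mulr0 ?subr0 ?subrr// neq_ltn ltnSn.
move=> jk; have -> : wdot (orth k.+1) (orth j) = 0 by apply: IHs; lia.
rewrite mulr0 subr0 wdotX; move: jk; rewrite leq_eqVlt => /predU1P[->|jk].
  rewrite betaE; case: k {IH kA} hk hj IHs alphaE betaE => [|k] hk hj IHs alphaE betaE.
    by rewrite X_orth0 wdotC wdotDl wdotCl [wdot (orth 0) (orth 1)]IHs// mulr0
       addr0 subrr.
  rewrite X_orth wdotC !wdotDl !wdotCl [wdot (orth k.+1) _]IHs; [|lia..].
  by rewrite [wdot (orth k) _]IHs ?mulr0 ?addr0 ?subrr//; lia.
rewrite [wdot (orth k) _]IHs ?mulr0 ?subr0//; [|lia..].
case: j jk => [|j] jk.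
  by rewrite X_orth0 wdotC wdotDl wdotCl !IHs ?mulr0 ?addr0//; lia.
by rewrite X_orth wdotC !wdotDl !wdotCl !IHs ?mulr0 ?addr0//; lia.
Qed.

(** Subtracting [lead_coef f] times the [orth m] of the same degree lowers the degree of [f]. *)
Lemma orth_lower_degree k f : (size f <= k)%N -> (k <= #|A|)%N ->
  wdot (orth k) f = 0.
Proof.
move=> szf kA.
have [m] : exists m, (size f <= m)%N by exists (size f).
elim: m f szf => [|m IHm] f szf szm.
  move: szm; rewrite leqn0 size_poly_eq0 => /eqP ->.
  by rewrite /wdot big1// => i _; rewrite horner0 !mulr0.
have [lt|ge] := leqP (size f) m; first exact: IHm.
have esz : size f = m.+1 by apply/eqP; rewrite eqn_leq szm ge.
pose c := lead_coef f.
have c0 : c != 0 by rewrite lead_coef_eq0 -size_poly_eq0 esz.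
have mk : (m < k)%N by rewrite -esz.
have -> : f = (f - c%:P * orth m) + c%:P * orth m by rewrite subrK.
rewrite wdotC wdotDl wdotCl ![wdot _ (orth k)]wdotC orth_orthogonal// mulr0 addr0.
have lt : (size (f - c%:P * orth m)%R < size f)%N.
  rewrite mul_polyC; apply: size_polyB_lt.
  - by rewrite size_scale// size_orth.
  - by rewrite lead_coefZ (eqP (orth_monic m)) mulr1.
  - by rewrite -lead_coef_eq0.
by apply: IHm; [rewrite ltnW// (leq_trans lt)|rewrite -ltnS -esz].
Qed.

(** Pairing with the cofactor of a node, which vanishes at all other nodes, isolates the value of
    [orth #|A|] there. So every node is a zero, and both sides are monic of degree [#|A|]. *)
Lemma orth_nodal : orth #|A| = nodal xi A.
Proof.
have z i : i \in A -> (orth #|A|).[xi i] = 0.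
  move=> iA; have := @orth_lower_degree #|A| (cofactor_at xi A i).
  rewrite size_cofactor_at// => /(_ (leqnn _) (leqnn _)).
  rewrite /wdot (bigD1 i)//= big1 => [|j /andP[jA ji]]; last first.
    by rewrite cofactor_at_eq0// !mulr0.
  rewrite addr0 => /eqP; rewrite !mulf_eq0 (negbTE (cofactor_at_neq0 _ _ _))//.
  by rewrite gt_eqF ?w_gt0// orbF /= => /eqP.
apply/eqP; rewrite -subr_eq0; apply/eqP.
rewrite [LHS](@nodal_numE _ _ _ xi_inj A).
  rewrite /nodal_num big1// => i iA; rewrite hornerD hornerN z//.
  have /rootP-> : root (nodal xi A) (xi i) by rewrite root_nodal_xi.
  by rewrite subrr mul0r polyC0 mul0r.
rewrite -ltnS -(size_orth #|A|); apply: size_polyB_lt.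
- by rewrite size_orth size_nodal.
- by rewrite (eqP (orth_monic _)) (eqP (nodal_monic _ _)).
- by rewrite monic_neq0 ?orth_monic.
Qed.

(** The right-hand side is the polynomial of the second kind attached to [orth k]; it satisfies the
    same recurrence as the numerators of the truncations. *)
Lemma jnum_jcoefs_off k x : (k <= #|A|)%N -> (forall i, i \in A -> x != xi i) ->
  (jnum (jcoefs k)).[x] =
  \sum_(i in A) w i * ((orth k).[x] - (orth k).[xi i]) / (x - xi i).
Proof.
move=> kA xA.
pose S k := \sum_(i in A) w i * ((orth k).[x] - (orth k).[xi i]) / (x - xi i).
suff : (jnum (jcoefs k)).[x] = S k /\
   ((k < #|A|)%N -> (jnum (jcoefs k.+1)).[x] = S k.+1) by case.
elim: k kA => [|k IH] kA.
  split=> [|_].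
    rewrite /S big1 ?horner0// => i iA.
    by rewrite /orth !hornerE subrr mulr0 mul0r.
  rewrite /= jnum_cons /jden /= mulr1 hornerC jbeta0 /wdot.
  apply: eq_bigr => i iA; rewrite orth1 !hornerE /=; field.
  by rewrite subr_eq0 xA.
have [IH0 /(_ kA) IH1] := IH (ltnW kA).
split=> // kA1.
have -> : jnum (jcoefs k.+2) = ('X - (jalpha k.+1)%:P) * jnum (jcoefs k.+1)
    - (jbeta k.+1)%:P * jnum (jcoefs k).
  by rewrite !jcoefsS (jfrac_rcons2 _ _ _).2.
move: (jnum (jcoefs k)) (jnum (jcoefs k.+1)) IH0 IH1 => u v IH0 IH1.
rewrite !hornerE /= IH0 IH1.
(* The difference quotient of ['X * orth k.+1] leaves an extra term [(orth k.+1).[xi i]]; its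
   weighted sum is this product. *)
have : wdot (orth k.+1) 1 = 0.
  by rewrite orth_lower_degree// size_poly1.
rewrite /wdot => e; apply/esym/eqP; rewrite -subr_eq0; apply/eqP; rewrite -{}e.
rewrite /S !mulr_sumr -!sumrB; apply: eq_bigr => i iA.
rewrite orthSS !hornerE /=; field.
by rewrite subr_eq0 xA.
Qed.

(** Existence in the inverse problem for one block. At [k = #|A|] the terms [(orth k).[xi i]] drop
    out of the second-kind sum, leaving [nodal] times a sum of simple fractions. *)
Lemma jfrac_jcoefs :
  jden (jcoefs #|A|) = nodal xi A /\ jnum (jcoefs #|A|) = nodal_num xi A w.
Proof.
rewrite jden_jcoefs orth_nodal; split=> //.
apply: (@poly_eq_off _ [seq xi i | i in A]) => x xA.
have {}xA i : i \in A -> x != xi i.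
  by move=> iA; apply: contraNneq xA => ->; apply: map_f; rewrite mem_enum.
rewrite jnum_jcoefs_off// horner_nodal_num_off// orth_nodal mulr_sumr.
apply: eq_bigr => i iA.
have /rootP-> : root (nodal xi A) (xi i) by rewrite root_nodal_xi.
by rewrite subr0; ring.
Qed.

Lemma jcoefs_gt0 : all (fun y => 0 < y.2) (jcoefs #|A|).
Proof.
apply/allP => y /mapP[k]; rewrite mem_iota /= add0n => kA -> /=.
case: k kA => [|k] kA; first by rewrite jbeta0 wdot_gt0 ?oner_eq0 ?size_poly1.
by rewrite jbetaS divr_gt0// orth_norm_gt0// ltnW.
Qed.

End OrthogonalPolynomials.

(** * Jacobi matrices and their perturbations *)

Section Tridiagonal.
Variable S : comNzRingType.
Implicit Types x u v : nat -> S.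

(** Over a commutative ring, so as to cover [X - J]; the entries are functions on [nat], so that
    deleting leading rows and columns amounts to a shift. *)
Definition tridiag x u v n : 'M[S]_n := \matrix_(i, j)
  if i == j :> nat then x i else if j == i.+1 :> nat then u i
  else if i == j.+1 :> nat then v j else 0.

Definition shift_seq (T : Type) (x : nat -> T) i := x i.+1.

Lemma det_tridiag1 x u v : \det (tridiag x u v 1) = x 0.
Proof. by rewrite det_mx11 mxE. Qed.

(** The continuant recurrence: expansion along the first row, then along the first column of the
    second minor. *)
Lemma det_tridiagSS x u v n : \det (tridiag x u v n.+2) =
  x 0 * \det (tridiag (shift_seq x) (shift_seq u) (shift_seq v) n.+1)
  - u 0 * v 0 * \det (tridiag (shift_seq (shift_seq x)) (shift_seq (shift_seq u))
      (shift_seq (shift_seq v)) n).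
Proof.
rewrite (expand_det_row _ ord0) 2!big_ord_recl big1 => [|j _]; last first.
  by rewrite mxE /= mul0r.
rewrite addr0 !mxE /=; congr (_ + _).
  rewrite /cofactor addn0 mul1r; congr (_ * \det _).
  by apply/matrixP => i j; rewrite !mxE !lift0 !eqSS.
rewrite /cofactor /= (expand_det_col _ ord0) big_ord_recl big1 => [|j _]; last first.
  by rewrite !mxE /= mul0r.
rewrite addr0 !mxE /= /cofactor /= /bump /= expr0 expr1 mul1r.
rewrite mulN1r mulrN mulrA; congr (- (_ * \det _)).
by apply/matrixP => i j; rewrite !mxE /= /bump /= !eqSS.
Qed.

End Tridiagonal.

Section JacobiMatrices.
Variable R : realFieldType.
Implicit Types a b : nat -> R.

(* The sites to the left, resp. to the right, of a given one, listed outwards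
   from it, each with the square of its coupling to the preceding site. *)
Fixpoint left_list a b n : seq (R * R) :=
  if n is n'.+1 then (a n', b n' ^+ 2) :: left_list a b n' else [::].

Fixpoint right_list a b k m : seq (R * R) :=
  if m is m'.+1 then (a k.+1, b k ^+ 2) :: right_list a b k.+1 m' else [::].

Lemma size_left_list a b n : size (left_list a b n) = n.
Proof. by elim: n => //= n ->. Qed.

Lemma size_right_list a b k m : size (right_list a b k m) = m.
Proof. by elim: m k => //= m IH k; rewrite IH. Qed.

Lemma nth_left_list z a b n i : (i < n)%N ->
  nth z (left_list a b n) i = (a (n - i.+1)%N, b (n - i.+1)%N ^+ 2).
Proof.
elim: n i => // n IH [|i] ltin; first by rewrite /= subSS subn0.
by rewrite /= IH// subSS.
Qed.

Lemma nth_right_list z a b k m i : (i < m)%N ->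
  nth z (right_list a b k m) i = (a (k + i).+1, b (k + i)%N ^+ 2).
Proof.
elim: m k i => // m IH k [|i] ltim; first by rewrite /= addn0.
by rewrite /= IH// addSnnS.
Qed.

Lemma right_list_shift a b k m :
  right_list (shift_seq a) (shift_seq b) k m = right_list a b k.+1 m.
Proof. by elim: m k => //= m IH k; rewrite IH. Qed.

Definition jacobi_mx a b n : 'M[R]_n := tridiag a b b n.

(** The continuant recurrence of [X - J] is the recursion of the J-fraction that starts at site
    0. *)
Lemma char_poly_jacobi_mx0 a b m :
  char_poly (jacobi_mx a b m.+1) = two_sided [::] (a 0) (right_list a b 0 m).
Proof.
pose D a b n := \det (tridiag (fun i => 'X - (a i)%:P) (fun i => - (b i)%:P)
  (fun i => - (b i)%:P) n) : {poly R}.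
have charD n : char_poly (jacobi_mx a b n) = D a b n.
  rewrite /char_poly; congr (\det _); apply/matrixP => i j; rewrite !mxE.
  rewrite -val_eqE /=; case: ifP => _; rewrite ?mulr1n// mulr0n.
  by case: ifP => _; [|case: ifP => _]; rewrite sub0r// polyC0 oppr0.
rewrite {}charD /two_sided [jden [::]]/(1 : {poly R}) [jnum [::]]/(0 : {poly R}).
rewrite !mul1r mul0r subr0.
suff H : D a b m.+1 = ('X - (a 0)%:P) * jden (right_list a b 0 m)
   - jnum (right_list a b 0 m) by [].
(* The recurrence refers to two shorter matrices with shifted entries, hence an induction on a bound
   for [m], for all [a] and [b]. *)
have [k] : exists k, (m <= k)%N by exists m.
elim: k a b m => [|k IH] a b m.
  rewrite leqn0 => /eqP ->; rewrite /D det_tridiag1 /jden /jnum /=; ring.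
case: m => [|m] mk.
  rewrite /D det_tridiag1 /jden /jnum /=; ring.
rewrite /D det_tridiagSS.
have -> : \det (tridiag (shift_seq (fun i => 'X - (a i)%:P))
      (shift_seq (fun i => - (b i)%:P)) (shift_seq (fun i => - (b i)%:P)) m.+1) =
   D (shift_seq a) (shift_seq b) m.+1 by [].
rewrite IH// right_list_shift /= jden_cons jnum_cons /= -/(jden _).
case: m mk => [|m] mk.
  rewrite det_mx00 /jden /jnum /= /shift_seq; ring.
have -> : \det (tridiag (shift_seq (shift_seq (fun i => 'X - (a i)%:P)))
   (shift_seq (shift_seq (fun i => - (b i)%:P))) (shift_seq (shift_seq (fun i => - (b i)%:P))) m.+1)
   = D (shift_seq (shift_seq a)) (shift_seq (shift_seq b)) m.+1 by [].
rewrite IH 1?ltnW// !right_list_shift /= jden_cons jnum_cons /= /shift_seq; ring.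
Qed.

Lemma char_poly_jacobi_mx a b n m :
  char_poly (jacobi_mx a b (n + m).+1) =
  two_sided (left_list a b n) (a n) (right_list a b n m).
Proof.
elim: n m => [|n IH] m; first exact: char_poly_jacobi_mx0.
by rewrite addSnnS IH /= two_sided_shift.
Qed.

End JacobiMatrices.

Section JacobiAccess.
Variables (R : realType) (N : nat).
Implicit Types J : 'M[R]_N.+1.

(** Entries as functions on [nat], to match [jacobi_mx]. Out of range [inord] falls back to index 0,
    so only [i <= N], resp. [i < N] for [offdiag_of], is meaningful. *)
Definition diag_of J i := J (inord i) (inord i).
Definition offdiag_of J i := J (inord i) (inord i.+1).

Lemma jacobi_jacobi_mx (a b : nat -> R) :
  (forall i, (i < N)%N -> b i < 0) -> jacobi (jacobi_mx a b N.+1).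
Proof.
move=> b0; split.
- apply/matrixP => i j; rewrite !mxE eq_sym.
  have [->//|_] := eqVneq (i : nat) j.
  by case: eqP => [->|_]; [rewrite ltn_eqF// ltnS ltnW|].
- by move=> i j ij; rewrite mxE !ifF//; apply/negP => /eqP; lia.
- move=> i j ij; rewrite mxE ifF; last by apply/negP => /eqP; lia.
  by rewrite ij eqxx b0// -ltnS -ij.
Qed.

Lemma jacobiP J : jacobi J ->
  J = jacobi_mx (diag_of J) (offdiag_of J) N.+1 /\
  (forall i, (i < N)%N -> offdiag_of J i < 0).
Proof.
move=> [symJ J0 Jneg]; split; last first.
  by move=> i iN; apply: Jneg; rewrite !inordK// ltnS ltnW.
have symE i j : J i j = J j i by rewrite -[in LHS]symJ mxE.
apply/matrixP => i j; rewrite mxE /diag_of /offdiag_of.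
case: eqP => [ij|nij]; first by rewrite inord_val; congr (J _ _); apply/val_inj.
case: eqP => [ij|ij]; first by rewrite -ij !inord_val.
case: eqP => [ji|ji]; first by rewrite -ji !inord_val symE.
have [lt|] := ltnP i j; first by rewrite J0//; lia.
by move=> le; rewrite symE J0//; lia.
Qed.

Lemma diag_of_jacobi_mx (a b : nat -> R) i : (i <= N)%N ->
  diag_of (jacobi_mx a b N.+1) i = a i.
Proof. by move=> iN; rewrite /diag_of mxE eqxx inordK. Qed.

Lemma offdiag_of_jacobi_mx (a b : nat -> R) i : (i < N)%N ->
  offdiag_of (jacobi_mx a b N.+1) i = b i.
Proof.
move=> iN; rewrite /offdiag_of mxE !inordK ?eqxx// ?(ltnW iN)//.
  by rewrite ltn_eqF.
exact: leqW.
Qed.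

End JacobiAccess.

Lemma eq_left_list (R : realFieldType) (a b a' b' : nat -> R) n :
  (forall i, (i < n)%N -> a i = a' i /\ b i = b' i) ->
  left_list a b n = left_list a' b' n.
Proof.
elim: n => //= n IH e; rewrite (e n _).1// (e n _).2// IH// => i lt.
by apply: e; apply: ltnW.
Qed.

Lemma eq_right_list (R : realFieldType) (a b a' b' : nat -> R) k m :
  (forall i, (k <= i < k + m)%N -> a i.+1 = a' i.+1 /\ b i = b' i) ->
  right_list a b k m = right_list a' b' k m.
Proof.
elim: m k => //= m IH k e.
have kk : (k <= k < k + m.+1)%N by lia.
rewrite (e k kk).1 (e k kk).2 IH// => i lt; apply: e; lia.
Qed.

Section Perturbation.
Variables (R : realType) (n m : nat).
Variables (theta K : R) (J : 'M[R]_((n + m).+1)).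

Let n' : 'I_((n + m).+1) := inord n.

Lemma perturbation_jacobi M : 0 < theta -> jacobi J ->
  jacobi (perturbation n' theta M J).
Proof.
move=> t0 [symJ J0 Jneg].
have symE i j : J i j = J j i by rewrite -[in LHS]symJ mxE.
split.
- apply/matrixP => i j; rewrite !mxE andbC orbC; case: ifP => // _.
  by rewrite symE.
- move=> i j ij; rewrite mxE ifF; last first.
    by apply/negP => /andP[/eqP + /eqP]; move: ij => /[swap] -> /[swap] ->; lia.
  by rewrite J0// mulr0 if_same.
- move=> i j ij; rewrite mxE ifF; last first.
    by apply/negP => /andP[/eqP + /eqP]; move: ij => /[swap] -> /[swap] ->; lia.
  have Jij := Jneg i j ij.
  by case: ifP => // _; rewrite pmulr_rlt0.
Qed.

Definition left_half := left_list (diag_of J) (offdiag_of J) n.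
Definition right_half := right_list (diag_of J) (offdiag_of J) n m.

Lemma char_poly_halves : jacobi J ->
  char_poly J = two_sided left_half (diag_of J n) right_half.
Proof. by move=> /jacobiP[eJ _]; rewrite [in LHS]eJ char_poly_jacobi_mx. Qed.

(** Only the diagonal entry at [n] and the couplings next to it change: both [jden] stay, and both
    [jnum] acquire the factor [theta ^+ 2]. *)
Lemma char_poly_perturbation : jacobi J -> theta != 0 ->
  char_poly (perturbation n' theta ((theta ^- 2 - 1) * K) J) =
  (theta ^+ 2)%:P * char_poly J +
  (1 - theta ^+ 2)%:P * ('X - K%:P) * (jden left_half * jden right_half).
Proof.
move=> jJ t0; rewrite char_poly_halves// /left_half /right_half.
have [eJ _] := jacobiP jJ; set M := _ * K.
set a := diag_of J; set b := offdiag_of J.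
pose a' i := if i == n then theta ^+ 2 * (a n + M) else a i.
pose b' i := if (i == n) || (i.+1 == n) then theta * b i else b i.
have nK : n' = n :> nat by rewrite inordK// ltnS leq_addr.
have -> : perturbation n' theta M J = jacobi_mx a' b' (n + m).+1.
  rewrite eJ -/a -/b; apply/matrixP => i j; rewrite !mxE -!val_eqE /= nK eqxx.
  rewrite /a' /b'.
  have [->|inn] := eqVneq (i : nat) n; have [hj|jn] := eqVneq (j : nat) n => //=.
  - case: eqP => // _; case: eqP => [e|_]; last by rewrite mulr0.
    by rewrite -e eqxx.
  - rewrite hj (negbTE inn); case: eqP => [e|_] /=; first by rewrite -e eqxx.
    by case: eqP => // _; rewrite mulr0.
  - case: eqP => // _; case: eqP => [e|_]; first by rewrite -e (negbTE jn).
    by case: eqP => // e; rewrite -e (negbTE inn).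
rewrite char_poly_jacobi_mx /two_sided.
have [-> ->] : jden (left_list a' b' n) = jden (left_list a b n) /\
    jnum (left_list a' b' n) = (theta ^+ 2)%:P * jnum (left_list a b n).
  rewrite /a' /b'; case: (n) => [|k] /=.
    by rewrite /jnum /= mulr0.
  have -> : left_list (fun i => if i == k.+1 then theta ^+ 2 * (a k.+1 + M) else a i)
       (fun i => if (i == k.+1) || (i.+1 == k.+1) then theta * b i else b i) k
       = left_list a b k.
    apply: eq_left_list => i ik; rewrite !ifF//; first by apply/negP => /orP[]/eqP; lia.
    by apply/negP => /eqP; lia.
  rewrite !jden_cons !jnum_cons /= eqxx orbT ifF; last by apply/negP => /eqP; lia.
  split=> //; rewrite exprMn polyCM; ring.
have [-> ->] : jden (right_list a' b' n m) = jden (right_list a b n m) /\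
    jnum (right_list a' b' n m) = (theta ^+ 2)%:P * jnum (right_list a b n m).
  rewrite /a' /b'; case: (m) => [|k] /=.
    by rewrite /jnum /= mulr0.
  have -> : right_list (fun i => if i == n then theta ^+ 2 * (a n + M) else a i)
       (fun i => if (i == n) || (i.+1 == n) then theta * b i else b i) n.+1 k
       = right_list a b n.+1 k.
    apply: eq_right_list => i ik; rewrite !ifF//; first by apply/negP => /orP[]/eqP; lia.
    by apply/negP => /eqP; lia.
  rewrite !jden_cons !jnum_cons /= eqxx /= ifF; last by apply/negP => /eqP; lia.
  split=> //; rewrite exprMn polyCM; ring.
rewrite /a' eqxx /M.
(* The value of [M] makes the new diagonal entry a combination of [a n] and [K] with weights of sum
   1; this produces the factor [X - K]. *)
have -> : theta ^+ 2 * (a n + (theta ^- 2 - 1) * K) =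
  theta ^+ 2 * a n + (1 - theta ^+ 2) * K by field.
rewrite !(polyCM, polyCD, polyCB); ring.
Qed.

End Perturbation.

Section Spectrum.
Variables (R : realType) (N : nat).
Implicit Type sigma : N.-tuple R.

Lemma spec_poly_monic sigma : spec_poly sigma \is monic.
Proof. exact: monic_prod_XsubC. Qed.

Lemma size_spec_poly sigma : size (spec_poly sigma) = N.+1.
Proof. by rewrite size_prod_XsubC size_tuple. Qed.

(** A spectrum as a set forgets multiplicities, but [N] distinct eigenvalues already exhaust the
    degree of the characteristic polynomial. *)
Lemma spectrumP sigma (J : 'M[R]_N) : uniq sigma ->
  spectrum J = [set x | x \in sigma]%classic <-> char_poly J = spec_poly sigma.
Proof.
move=> us; split=> [e|e]; last first.
  by apply/seteqP; split=> x; rewrite /spectrum /= eigenvalue_root_char e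
    root_prod_XsubC.
have rt : all (root (char_poly J)) sigma.
  apply/allP => x xs; rewrite -eigenvalue_root_char.
  by have : [set x | x \in sigma]%classic x by []; rewrite -e.
have := all_roots_prod_XsubC _ rt _; rewrite uniq_rootsE us size_char_poly size_tuple.
by move=> /(_ erefl isT) ->; rewrite (eqP (char_poly_monic J)) scale1r.
Qed.

End Spectrum.

(** * Assembling a Jacobi matrix from its center and its two halves *)

Section Glue.
Variables (R : realType) (n m : nat).
Implicit Types l r : seq (R * R).

(** The lists run outwards from site [n], so the left one is read backwards. They store squares of
    couplings; the off-diagonal entries are the negative square roots. *)
Definition glue_diag l a r i : R :=
  if (i < n)%N then (nth (0, 0) l (n - i.+1)%N).1
  else if i == n then a else (nth (0, 0) r (i - n.+1)%N).1.

Definition glue_offdiag l r i : R :=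
  - Num.sqrt (if (i < n)%N then (nth (0, 0) l (n - i.+1)%N).2
              else (nth (0, 0) r (i - n)%N).2).

Definition glue l a r : 'M[R]_((n + m).+1) :=
  jacobi_mx (glue_diag l a r) (glue_offdiag l r) (n + m).+1.

Lemma glue_offdiag_lt0 l r i : size l = n -> size r = m ->
  all (fun y => 0 < y.2) l -> all (fun y => 0 < y.2) r -> (i < n + m)%N ->
  glue_offdiag l r i < 0.
Proof.
move=> sl sr /(all_nthP (0, 0)) l0 /(all_nthP (0, 0)) r0 inm.
rewrite oppr_lt0 sqrtr_gt0; case: ifPn => [lt|].
  by apply: l0; rewrite sl; lia.
by rewrite -leqNgt => le; apply: r0; rewrite sr; lia.
Qed.

Lemma glue_jacobi l a r : size l = n -> size r = m ->
  all (fun y => 0 < y.2) l -> all (fun y => 0 < y.2) r -> jacobi (glue l a r).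
Proof.
by move=> sl sr l0 r0; apply: jacobi_jacobi_mx => i inm; apply: glue_offdiag_lt0.
Qed.

Lemma left_half_glue l a r : size l = n -> all (fun y => 0 < y.2) l ->
  left_half (glue l a r) = l.
Proof.
move=> sl /(all_nthP (0, 0)) l0; apply: (@eq_from_nth _ (0, 0)); rewrite size_left_list//.
move=> i ilt; rewrite nth_left_list// diag_of_jacobi_mx ?offdiag_of_jacobi_mx; [|lia..].
have lt : (n - i.+1 < n)%N by lia.
rewrite /glue_diag /glue_offdiag lt.
have -> : (n - (n - i.+1).+1)%N = i by lia.
by rewrite sqrrN sqr_sqrtr ?ltW ?l0 ?sl//; case: nth.
Qed.

Lemma right_half_glue l a r : size r = m -> all (fun y => 0 < y.2) r ->
  right_half (glue l a r) = r.
Proof.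
move=> sl /(all_nthP (0, 0)) r0; apply: (@eq_from_nth _ (0, 0)); rewrite size_right_list//.
move=> i ilt; rewrite nth_right_list// diag_of_jacobi_mx ?offdiag_of_jacobi_mx; [|lia..].
rewrite /glue_diag /glue_offdiag ifF; last by lia.
rewrite ifF; last by lia.
rewrite ifF; last by lia.
have -> : ((n + i).+1 - n.+1)%N = i by lia.
have -> : (n + i - n)%N = i by lia.
by rewrite sqrrN sqr_sqrtr ?ltW ?r0 ?sl//; case: nth.
Qed.

Lemma glue_center l a r : diag_of (glue l a r) n = a.
Proof. by rewrite diag_of_jacobi_mx ?leq_addr// /glue_diag ltnn eqxx. Qed.

Lemma glueK (J : 'M[R]_((n + m).+1)) : jacobi J ->
  glue (left_half J) (diag_of J n) (right_half J) = J.
Proof.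
move=> /jacobiP[eJ b0]; rewrite [RHS]eJ.
have eb i : (i < n + m)%N ->
    glue_offdiag (left_half J) (right_half J) i = offdiag_of J i.
  move=> inm; rewrite /glue_offdiag; case: ifPn => [lt|le].
    rewrite nth_left_list; last lia.
    have -> : (n - (n - i.+1).+1)%N = i by lia.
    by rewrite /= sqrtr_sqr ltr0_norm ?b0// opprK.
  rewrite nth_right_list; last lia.
  have -> : (n + (i - n))%N = i by lia.
  by rewrite /= sqrtr_sqr ltr0_norm ?b0// opprK.
apply/matrixP => i j; rewrite !mxE; case: ifP => _.
  rewrite /glue_diag; case: ifPn => [lt|le].
    rewrite nth_left_list; last lia.
    by have -> : (n - (n - i.+1).+1)%N = i by lia.
  case: eqP => [->//|ne]; have := ltn_ord i; rewrite ltnS => inm.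
  rewrite nth_right_list; last lia.
  by have -> : (n + (i - n.+1)).+1 = i by lia.
have := ltn_ord i; have := ltn_ord j => jn ln.
case: eqP => [e|_]; first by rewrite eb//; lia.
by case: eqP => [e|_]; first by rewrite eb//; lia.
Qed.

End Glue.

(** At a zero of [jden] the Wronskian reduces to this product: the zero is simple and [jnum / jden]
    has a positive residue there. *)
Lemma jden_simple_root (R : realFieldType) (l : seq (R * R)) x :
  all (fun y => 0 < y.2) l -> root (jden l) x ->
  0 < (jden l)^`().[x] * (jnum l).[x].
Proof.
move=> l0 rx; have ln : l != [::].
  by apply: contraTneq rx => ->; rewrite /jden /= rootE hornerE oner_eq0.
have := jfrac_wronskian_gt0 x l0 ln.
by rewrite /wronskian hornerD hornerN !hornerM (rootP rx) mul0r subr0.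
Qed.

(** * Jacobi matrices with given characteristic polynomials *)

Section Components.
Variables (R : realType) (n m d s : nat).
Local Notation I := ('I_d + 'I_s)%type.
Variables (xi : I -> R) (c : I -> R) (a0 : R).
Hypothesis xi_inj : injective xi.
Hypothesis c_gt0 : forall i, 0 < c i.
Hypothesis nmE : (n + m = d + d + s)%N.
Implicit Types (T : {set 'I_s}) (t : 'I_d -> R).

(* [I] indexes the distinct zeros of the product of the characteristic
   polynomials of the two halves: ['I_d] the double ones, which are eigenvalues
   of both halves, and ['I_s] the simple ones. [T] consists of the simple zeros
   given to the left half; the nodes of the right half are [left_nodes (~: T)]. *)
Definition common : {set I} := [set i | if i is inl _ then true else false]%SET.
Definition left_nodes T : {set I} :=
  [set i | if i is inr j then j \in T else true]%SET.

(** The prescribed minor of [X - J] at site [n]: all zeros once, and the double ones a second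
    time. *)
Definition minor_poly : {poly R} := nodal xi finset.setT * nodal xi common.
(* [full_poly / minor_poly = X - a0 - \sum_i c i / (X - xi i)] *)
Definition full_poly : {poly R} :=
  ('X - a0%:P) * minor_poly - nodal xi common * nodal_num xi finset.setT c.

(* A residue [c i] at a double zero is shared between the two halves. *)
Definition left_weight t (i : I) : R := if i is inl k then t k * c i else c i.
Definition right_weight t (i : I) : R :=
  if i is inl k then (1 - t k) * c i else c i.

Definition model T t : 'M[R]_((n + m).+1) :=
  glue n m (jcoefs xi (left_nodes T) (left_weight t) n) a0
           (jcoefs xi (left_nodes (~: T)) (right_weight t) m).

Lemma card_left_nodes T : #|left_nodes T| = (d + #|T|)%N.
Proof.
rewrite -!sum1_card big_sumType /=; congr (_ + _)%N.
  by rewrite (eq_bigl xpredT) ?sum1_card ?card_ord// => i; rewrite inE.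
by apply: eq_bigl => j; rewrite inE.
Qed.

Lemma nodal_sum (A : {set I}) : nodal xi A =
  \prod_(k < d | inl k \in A) ('X - (xi (inl k))%:P) *
  \prod_(j < s | inr j \in A) ('X - (xi (inr j))%:P).
Proof. by rewrite /nodal big_sumType. Qed.

Lemma nodal_left_right T :
  nodal xi (left_nodes T) * nodal xi (left_nodes (~: T)) = minor_poly.
Proof.
rewrite /minor_poly !nodal_sum.
rewrite [X in _ * X * (_ * _) = _](_ : _ = \prod_(j in T) ('X - (xi (inr j))%:P));
  last by apply: eq_bigl => j; rewrite inE.
rewrite [X in _ * _ * (_ * X) = _](_ : _ = \prod_(j in ~: T) ('X - (xi (inr j))%:P));
  last by apply: eq_bigl => j; rewrite inE.
rewrite [X in _ = _ * X * _](_ : _ = \prod_j ('X - (xi (inr j))%:P));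
  last by apply: eq_bigl => j; rewrite inE.
rewrite [X in _ = _ * (_ * X)](_ : _ = 1); last by rewrite big1// => j; rewrite inE.
have e (A : {set I}) : (forall k, inl k \in A) ->
    \prod_(k < d | inl k \in A) ('X - (xi (inl k))%:P) =
    \prod_(k < d) ('X - (xi (inl k))%:P).
  by move=> kA; apply: eq_bigl => k; rewrite kA.
rewrite !e; [|by move=> k; rewrite inE..].
have -> : \prod_j ('X - (xi (inr j))%:P) = \prod_(j in T) ('X - (xi (inr j))%:P) *
   \prod_(j in ~: T) ('X - (xi (inr j))%:P).
  by rewrite (bigID (mem T)) /=; congr (_ * _); apply: eq_bigl => j; rewrite inE.
ring.
Qed.

Definition total_weight (A B : {set I}) (w v : I -> R) (i : I) : R :=
  (if i \in A then w i else 0) + (if i \in B then v i else 0).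

(** Addition of partial fractions, checked off the nodes; at a shared node the two weights add
    up. *)
Lemma nodal_num_combine (A B C : {set I}) w v :
  nodal xi A * nodal xi B = nodal xi finset.setT * nodal xi C ->
  nodal_num xi A w * nodal xi B + nodal xi A * nodal_num xi B v =
  nodal xi C * nodal_num xi finset.setT (total_weight A B w v).
Proof.
move=> e; apply: (@poly_eq_off R [seq xi i | i : I]) => x xI.
have {}xI i : x != xi i.
  by apply: contraNneq xI => ->; apply: map_f; rewrite mem_enum.
rewrite !(hornerD, hornerM) !horner_nodal_num_off//.
have {}e := congr1 (horner^~ x) e; rewrite /= !hornerM in e.
rewrite mulrAC mulrA -mulrDr e.
rewrite -mulrA mulrCA; congr (_ * (_ * _)).
rewrite /total_weight; under [RHS]eq_bigr do rewrite mulrDl.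
rewrite big_split /=; congr (_ + _).
  rewrite big_mkcond; apply: eq_big => i; rewrite ?inE//.
  by case: ifP => //; rewrite mul0r.
rewrite big_mkcond; apply: eq_big => i; rewrite ?inE//.
by case: ifP => //; rewrite mul0r.
Qed.

Section Model.
Variables (T : {set 'I_s}) (t : 'I_d -> R).
Hypothesis cardT : (d + #|T|)%N = n.
Hypothesis t01 : forall k, 0 < t k < 1.

Lemma card_right_nodes : #|left_nodes (~: T)| = m.
Proof.
rewrite card_left_nodes; have := cardsC T; rewrite card_ord; lia.
Qed.

Lemma left_weight_gt0 i : 0 < left_weight t i.
Proof.
by case: i => [k|j] /=; rewrite ?mulr_gt0//; case/andP: (t01 k).
Qed.

Lemma right_weight_gt0 i : 0 < right_weight t i.
Proof.
by case: i => [k|j] /=; rewrite ?mulr_gt0// subr_gt0; case/andP: (t01 k).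
Qed.

Lemma jfrac_model_left : let l := jcoefs xi (left_nodes T) (left_weight t) n in
  [/\ size l = n, all (fun y => 0 < y.2) l, jden l = nodal xi (left_nodes T)
    & jnum l = nodal_num xi (left_nodes T) (left_weight t)].
Proof.
have cL : #|left_nodes T| = n by rewrite card_left_nodes.
have w0 i : i \in left_nodes T -> 0 < left_weight t i by move=> _; exact: left_weight_gt0.
have [e1 e2] := jfrac_jcoefs xi_inj w0; have e3 := jcoefs_gt0 xi_inj w0.
move: e1 e2 e3; rewrite cL => e1 e2 e3; split=> //; exact: size_mkseq.
Qed.

Lemma jfrac_model_right :
  let r := jcoefs xi (left_nodes (~: T)) (right_weight t) m in
  [/\ size r = m, all (fun y => 0 < y.2) r, jden r = nodal xi (left_nodes (~: T))
    & jnum r = nodal_num xi (left_nodes (~: T)) (right_weight t)].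
Proof.
have cL := card_right_nodes.
have w0 i : i \in left_nodes (~: T) -> 0 < right_weight t i.
  by move=> _; exact: right_weight_gt0.
have [e1 e2] := jfrac_jcoefs xi_inj w0; have e3 := jcoefs_gt0 xi_inj w0.
move: e1 e2 e3; rewrite cL => e1 e2 e3; split=> //; exact: size_mkseq.
Qed.

Lemma total_weight_model i :
  total_weight (left_nodes T) (left_nodes (~: T)) (left_weight t) (right_weight t) i
  = c i.
Proof.
rewrite /total_weight !inE; case: i => [k|j] /=; first by ring.
by rewrite inE; case: (j \in T); rewrite /= ?addr0 ?add0r.
Qed.

Lemma left_half_model :
  left_half (model T t) = jcoefs xi (left_nodes T) (left_weight t) n.
Proof. by have [? ? _ _] := jfrac_model_left; rewrite left_half_glue. Qed.

Lemma right_half_model :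
  right_half (model T t) = jcoefs xi (left_nodes (~: T)) (right_weight t) m.
Proof. by have [? ? _ _] := jfrac_model_right; rewrite right_half_glue. Qed.

(** The shares [t] and [1 - t] have sum 1, so the partial fractions of the halves add up to the one
    in [full_poly] whatever [t] is. *)
Lemma model_spec : [/\ jacobi (model T t), char_poly (model T t) = full_poly
  & jden (left_half (model T t)) * jden (right_half (model T t)) = minor_poly].
Proof.
have [sl l0 pl ql] := jfrac_model_left; have [sr r0 pr qr] := jfrac_model_right.
have jJ : jacobi (model T t) by apply: glue_jacobi.
split=> //.
  rewrite char_poly_halves// left_half_model right_half_model glue_center.
  rewrite /two_sided pl pr ql qr nodal_left_right /full_poly -addrA -opprD.
  rewrite (nodal_num_combine (C := common)) ?nodal_left_right//.
  by congr (_ - _ * _); apply: eq_nodal_num => i _; rewrite total_weight_model.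
by rewrite left_half_model right_half_model pl pr nodal_left_right.
Qed.

Lemma jden_left_model : jden (left_half (model T t)) = nodal xi (left_nodes T).
Proof. by rewrite left_half_model; case: jfrac_model_left. Qed.

Lemma jnum_left_model k : (jnum (left_half (model T t))).[xi (inl k)] =
  t k * c (inl k) * (cofactor_at xi (left_nodes T) (inl k)).[xi (inl k)].
Proof.
rewrite left_half_model; case: jfrac_model_left => _ _ _ ->.
by rewrite horner_nodal_num// inE.
Qed.

End Model.

Lemma nodal_dvd (A : {set I}) (p : {poly R}) : (forall i, i \in A -> root p (xi i)) ->
  exists q, p = q * nodal xi A.
Proof.
move=> rA.
have rt : all (root p) [seq xi i | i in A].
  by apply/allP => x /mapP[i]; rewrite mem_enum => iA ->; apply: rA.
have ur : uniq_roots [seq xi i | i in A].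
  by rewrite uniq_rootsE map_inj_uniq// enum_uniq.
have [q ->] := uniq_roots_prod_XsubC rt ur; exists q; congr (_ * _).
by rewrite big_map big_enum.
Qed.

Lemma monic_mul_eq1 (u v : {poly R}) : u \is monic -> u * v = 1 -> u = 1.
Proof.
move=> mu uv1; have u0 := monic_neq0 mu.
have v0 : v != 0 by apply: contra_eq_neq uv1 => ->; rewrite mulr0 eq_sym oner_neq0.
have : size (u * v)%R = 1%N by rewrite uv1 size_poly1.
rewrite size_mul// => e.
have su : size u = 1%N.
  move: e u0 v0; rewrite -!size_poly_gt0.
  by case: (size u) => [|[|k]]//; case: (size v) => [|k']//; rewrite addnS !addSn.
have /size_poly1P[x x0 ux] : size u == 1%N by rewrite su.
by move: mu; rewrite ux monicE lead_coefC => /eqP ->.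
Qed.

(** The way in which the zeros of [minor_poly] are distributed between the two denominators fixes
    [T]; the residues of the two J-fractions add up to [c], and the left shares fix [t]; [jfrac_inj]
    then identifies the halves. *)
Lemma model_onto (J : 'M[R]_((n + m).+1)) : jacobi J -> char_poly J = full_poly ->
  jden (left_half J) * jden (right_half J) = minor_poly ->
  exists T t, [/\ (d + #|T|)%N = n, forall k, 0 < t k < 1 & J = model T t].
Proof.
move=> jJ; rewrite char_poly_halves//.
have [_ b0] := jacobiP jJ.
have sq i : (i < n + m)%N -> 0 < offdiag_of J i ^+ 2.
  by move=> /b0 lt; rewrite lt_def sqr_ge0 sqrf_eq0 lt_eqF.
have l0 : all (fun y => 0 < y.2) (left_half J).
  apply/(all_nthP (0, 0)) => i; rewrite size_left_list => ilt.
  by rewrite nth_left_list//= sq//; lia.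
have r0 : all (fun y => 0 < y.2) (right_half J).
  apply/(all_nthP (0, 0)) => i; rewrite size_right_list => ilt.
  by rewrite nth_right_list//= sq//; lia.
have sl : size (left_half J) = n := size_left_list _ _ _.
have sr : size (right_half J) = m := size_right_list _ _ _ _.
move=> eP eQ; suff [T [t [cT t01 eJ]]] : exists T t, [/\ (d + #|T|)%N = n,
    forall k, 0 < t k < 1
    & glue n m (left_half J) (diag_of J n) (right_half J) = model T t].
  by exists T, t; split=> //; rewrite -eJ glueK.
move: eP eQ.
move: (left_half J) (right_half J) (diag_of J n) l0 r0 sl sr => l r a l0 r0 sl sr.
move=> eP eQ; clear b0 sq.
have simple (h : seq (R * R)) x : all (fun y => 0 < y.2) h -> root (jden h) x ->
    (jden h)^`().[x] != 0.
  by move=> h0 /(jden_simple_root h0); apply: contraTneq => ->; rewrite mul0r ltxx.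
have root_either i : root (jden l) (xi i) || root (jden r) (xi i).
  by rewrite -rootM eQ rootM root_nodal_xi// inE.
(* If only one factor vanished at a double zero of the product, that factor would have a double
   zero, but its zeros are simple. *)
have root_both k : root (jden l) (xi (inl k)) && root (jden r) (xi (inl k)).
  have /rootP : root minor_poly^`() (xi (inl k)).
    apply/rootP; rewrite /minor_poly derivM hornerD !hornerM.
    have /rootP-> : root (nodal xi common) (xi (inl k)) by rewrite root_nodal_xi// inE.
    have /rootP-> : root (nodal xi finset.setT) (xi (inl k)) by rewrite root_nodal_xi// inE.
    by rewrite mulr0 mul0r addr0.
  rewrite -eQ derivM hornerD !hornerM.
  case/orP: (root_either (inl k)) => rk; rewrite rk ?andbT /=.
    rewrite (rootP rk) mul0r addr0 => /eqP; rewrite mulf_eq0.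
    by rewrite (negbTE (simple _ _ l0 rk)).
  rewrite (rootP rk) mulr0 add0r => /eqP; rewrite mulf_eq0 orbC.
  by rewrite (negbTE (simple _ _ r0 rk)).
pose T := [set j | root (jden l) (xi (inr j))]%SET.
have [u lE] : exists u, jden l = u * nodal xi (left_nodes T).
  apply: nodal_dvd => -[k|j]; rewrite !inE => h//.
  by case/andP: (root_both k).
have [v rE] : exists v, jden r = v * nodal xi (left_nodes (~: T)).
  apply: nodal_dvd => -[k|j]; rewrite !inE => h//.
    by case/andP: (root_both k).
  by have := root_either (inr j); rewrite (negbTE h).
have Q0 : minor_poly != 0 by rewrite mulf_neq0// monic_neq0// nodal_monic.
(* The nodes assigned to the two halves already account for all of [minor_poly], so the remaining
   monic factors are 1. *)
have uv1 : u * v = 1.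
  apply: (mulIf Q0); rewrite mul1r -[in LHS](nodal_left_right T) -eQ lE rE; ring.
have mu : u \is monic.
  by rewrite -(monicMr _ (nodal_monic xi (left_nodes T))) -lE jden_monic.
have mv : v \is monic.
  by rewrite -(monicMr _ (nodal_monic xi (left_nodes (~: T)))) -rE jden_monic.
have {u mu uv1 mv v} [{}lE {}rE] : jden l = nodal xi (left_nodes T) /\
    jden r = nodal xi (left_nodes (~: T)).
  rewrite lE rE (monic_mul_eq1 mu uv1) (@monic_mul_eq1 v u) ?mul1r//.
  by rewrite mulrC.
clearbody T.
have cl : #|left_nodes T| = n.
  by apply/succn_inj; rewrite -(size_nodal xi) -lE size_jden sl.
have cr : #|left_nodes (~: T)| = m.
  by apply/succn_inj; rewrite -(size_nodal xi) -rE size_jden sr.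
pose weight (h : seq (R * R)) (A : {set I}) (i : I) := (jnum h).[xi i] / (cofactor_at xi A i).[xi i].
have weightE (h : seq (R * R)) (A : {set I}) : (size h <= #|A|)%N -> jnum h = nodal_num xi A (weight h A).
  by move=> le; apply: nodal_numE => //; apply: leq_trans (size_jnum h) le.
have weight_gt0 (h : seq (R * R)) (A : {set I}) i : all (fun y => 0 < y.2) h ->
    jden h = nodal xi A -> i \in A -> 0 < weight h A i.
  move=> h0 hE iA; have : root (jden h) (xi i) by rewrite hE root_nodal_xi.
  move/(jden_simple_root h0); rewrite hE horner_deriv_nodal// /weight => h1.
  have c0 := cofactor_at_neq0 xi_inj A i.
  by rewrite div_gt0_mul// mulrC.
have lnE := weightE l (left_nodes T); rewrite cl sl leqnn in lnE; have {}lnE := lnE isT.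
have rnE := weightE r (left_nodes (~: T)); rewrite cr sr leqnn in rnE.
have {weightE}rnE := rnE isT.
have lw0 i := weight_gt0 l (left_nodes T) i l0 lE.
have rw0 i := weight_gt0 r (left_nodes (~: T)) i r0 rE.
move: (weight l (left_nodes T)) (weight r (left_nodes (~: T))) lnE rnE lw0 rw0
  => wl wr lnE rnE lw0 rw0; clear weight weight_gt0.
move: eP; rewrite /two_sided eQ -addrA -opprD lnE rnE lE rE.
rewrite (nodal_num_combine (C := common)) ?nodal_left_right// /full_poly.
set e := total_weight _ _ _ _ => eP.
have eP' : (a - a0)%:P * minor_poly = nodal xi common *
    (nodal_num xi finset.setT c - nodal_num xi finset.setT e).
  transitivity ((('X - a0%:P) * minor_poly - nodal xi common * nodal_num xi finset.setT c)
    - (('X - a%:P) * minor_poly - nodal xi common * nodal_num xi finset.setT e)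
    + nodal xi common * (nodal_num xi finset.setT c - nodal_num xi finset.setT e)).
    rewrite polyCB; ring.
  by rewrite eP subrr add0r.
(* If [a] and [a0] differed, the left side of [eP'] would have the size of [minor_poly], while the
   right side is smaller. *)
have ea : a = a0.
  apply/eqP; rewrite -subr_eq0; apply: contraT => ne.
  have : (size ((a - a0)%:P * minor_poly)%R < size minor_poly)%N.
    rewrite eP' /minor_poly (size_monicM (nodal_monic xi finset.setT)); last first.
      by rewrite monic_neq0 ?nodal_monic.
    have [->|ne0] := eqVneq (nodal_num xi finset.setT c - nodal_num xi finset.setT e) 0.
      by rewrite mulr0 size_poly0 !size_nodal addnS addSn.
    rewrite (size_monicM (nodal_monic _ _))//.
    have : (size (nodal_num xi finset.setT c - nodal_num xi finset.setT e)%R <= #|finset.setT : {set I}|)%N.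
      by rewrite (leq_trans (size_polyD _ _))// size_polyN geq_max !size_nodal_num.
    rewrite !size_nodal !addSn !addnS /= ltnS => le.
    by rewrite addnC leq_add2r.
  by rewrite mul_polyC size_scale// ltnn.
have ec i : e i = c i.
  move: eP'; rewrite ea subrr polyC0 mul0r => /esym/eqP.
  rewrite mulf_eq0 (negbTE (monic_neq0 (nodal_monic _ _)))/= subr_eq0 => /eqP/esym.
  by move=> /(nodal_num_inj xi_inj)/(_ i); rewrite inE => ->.
(* The left share of the residue at a double zero; positivity of the right share will give
   [t k < 1]. *)
pose t k := wl (inl k) / c (inl k).
have wlE i : i \in left_nodes T -> wl i = left_weight t i.
  case: i => [k|j] iT; rewrite /= ?/t ?divfK ?gt_eqF//.
  have jT : j \in T by move: iT; rewrite inE.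
  by have := ec (inr j); rewrite /e /total_weight !inE ?finset.in_setC jT /= addr0.
have wrE i : i \in left_nodes (~: T) -> wr i = right_weight t i.
  have := ec i; rewrite /e /total_weight; case: i => [k|j] ei iT.
    move: ei; rewrite !inE /= mulrBl mul1r /t divfK ?gt_eqF// => <-; ring.
  have jT : j \notin T by move: iT; rewrite !inE.
  by move: ei; rewrite !inE ?finset.in_setC (negbTE jT) /= add0r.
have t01 k : 0 < t k < 1.
  have lk : 0 < wl (inl k) by apply: lw0; rewrite inE.
  have rk : 0 < wr (inl k) by apply: rw0; rewrite inE.
  rewrite /t divr_gt0//= ltr_pdivrMr// mul1r -ec /e /total_weight !inE.
  by rewrite ltrDl.
exists T, t; rewrite -card_left_nodes; split=> //.
have cT : (d + #|T|)%N = n by rewrite -card_left_nodes.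
have [sl' l0' dl' nl'] := jfrac_model_left cT t01.
have [sr' r0' dr' nr'] := jfrac_model_right cT t01.
rewrite /model -ea; congr glue; apply: jfrac_inj => //.
- by rewrite sl sl'.
- by rewrite lE dl'.
- by rewrite lnE nl'; apply: eq_nodal_num.
- by rewrite sr sr'.
- by rewrite rE dr'.
- by rewrite rnE nr'; apply: eq_nodal_num.
Qed.

End Components.

(** * Smooth functions *)

Section SmoothFunctions.
Local Open Scope classical_set_scope.
Context {R : realType}.

(** With the zero differential the remainder vanishes near [x]. Functions that agree near [x] differ
    by such an [h], whence the locality of differentiability. *)
Lemma near_zero_differentiable (E F : normedModType R) (h : E -> F) (x : E) :
  (\near x, h x = 0) -> differentiable h x.
Proof.
move=> h0; have hx := nbhs_singleton h0.
pose z : {linear E -> F} := \0.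
have cz : continuous (z : E -> F) by move=> ?; exact: cst_continuous.
have e : h \o shift x = cst (h x) + (z : E -> F) +o_ 0 id.
  apply/eqaddoP => eps eps0.
  move: h0; rewrite (near_shift 0) subr0 => h0; near=> y.
  have -> : (h \o shift x - (cst (h x) + (z : E -> F))) y = 0.
    rewrite !fctE /= hx addr0 subr0.
    by have : (fun x => h x = 0) (shift x y) by near: y.
  by rewrite normr0 mulr_ge0// ltW.
by apply/diff_locallyP; rewrite (diff_unique cz e); split.
Unshelve. all: by end_near. Qed.

Lemma near_eq_differentiable (E F : normedModType R) (f g : E -> F) (x : E) :
  (\near x, f x = g x) -> differentiable f x -> differentiable g x.
Proof.
move=> fg df; have -> : g = f + (g - f) by rewrite addrC subrK.
apply: differentiableD => //; apply: near_zero_differentiable.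
by apply: filterS fg => y; rewrite !fctE => ->; rewrite subrr.
Qed.

Section FixedDomain.
Variables (E : normedModType R) (U : set E).
Hypothesis oU : open U.

(** Allows a directional derivative to be replaced by a formula that is valid on [U] only. *)
Lemma eq_Ck (F : normedModType R) k (f g : E -> F) :
  (forall x, U x -> f x = g x) -> Ck k U f -> Ck k U g.
Proof.
elim: k f g => [|k IH] f g fg /=.
  move=> cf x Ux; have := cf x Ux; rewrite /prop_for /continuous_at (fg x Ux).
  apply: cvg_trans; apply: near_eq_cvg.
  by apply: filterS (open_nbhs_nbhs (conj oU Ux)) => y Uy; rewrite /= fg.
have nfg x : U x -> \near x, f x = g x.
  by move=> Ux; apply: filterS (open_nbhs_nbhs (conj oU Ux)).
move=> [df Df]; split=> [x Ux|v].
  by apply: near_eq_differentiable (nfg x Ux) (df x Ux).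
by apply: IH (Df v) => x Ux; apply/near_eq_derive/nfg.
Qed.

(** Derivatives of products, inverses and square roots involve the functions themselves, which the
    inductions below need one order lower. *)
Lemma CkS (F : normedModType R) k (f : E -> F) : Ck k.+1 U f -> Ck k U f.
Proof.
elim: k f => [|k IH] f [df Df].
  by move=> x Ux; apply/differentiable_continuous/df.
by split=> // v; apply: IH; apply: Df.
Qed.

Lemma Ck_cst (F : normedModType R) k (a : F) : Ck k U (cst a).
Proof.
elim: k a => [|k IH] a /=; first by move=> x _; exact: cst_continuous.
split=> [x _|v]; first exact: differentiable_cst.
by apply: (eq_Ck _ (IH 0)) => x _; rewrite derive_cst.
Qed.

Lemma CkD (F : normedModType R) k (f g : E -> F) :
  Ck k U f -> Ck k U g -> Ck k U (fun x => f x + g x).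
Proof.
elim: k f g => [|k IH] f g /=.
  by move=> cf cg x Ux; apply: continuousD; [apply: cf|apply: cg].
move=> [df Df] [dg Dg]; split=> [x Ux|v].
  by apply: differentiableD; [apply: df|apply: dg].
apply: (eq_Ck _ (IH _ _ (Df v) (Dg v))) => x Ux.
by rewrite -deriveD//; apply: diff_derivable; [apply: df|apply: dg].
Qed.

Lemma CkZl (F : normedModType R) k (f : E -> R) (a : F) :
  Ck k U f -> Ck k U (fun x => f x *: a).
Proof.
elim: k f => [|k IH] f /=.
  by move=> cf x Ux; apply: cvgZ; [apply: cf|apply: cvg_cst].
move=> [df Df]; split=> [x Ux|v]; first by apply: differentiableZl; apply: df.
apply: (eq_Ck _ (IH _ (Df v))) => x Ux.
have dfx := df x Ux; have dzx := differentiableZl a dfx.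
by rewrite (deriveE _ dfx) (deriveE _ dzx) diffZl.
Qed.

Lemma CkM k (f g : E -> R) : Ck k U f -> Ck k U g -> Ck k U (fun x => f x * g x).
Proof.
elim: k f g => [|k IH] f g.
  by move=> cf cg x Ux; apply: continuousM; [apply: cf|apply: cg].
move=> cf cg; have cf' := CkS cf; have cg' := CkS cg.
case: cf cg => [df Df] [dg Dg]; split=> [x Ux|v].
  by apply: differentiableM; [apply: df|apply: dg].
apply: (eq_Ck _ (CkD (IH _ _ cf' (Dg v)) (IH _ _ cg' (Df v)))) => x Ux.
by rewrite deriveM//; apply: diff_derivable; [apply: df|apply: dg].
Qed.

Lemma CkN k (f : E -> R) : Ck k U f -> Ck k U (fun x => - f x).
Proof.
move=> cf; apply: (eq_Ck _ (CkM (Ck_cst k (-1 : R)) cf)) => x _.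
by rewrite mulN1r.
Qed.

Lemma CkV k (f : E -> R) : (forall x, U x -> f x != 0) -> Ck k U f ->
  Ck k U (fun x => (f x)^-1).
Proof.
move=> f0; elim: k => [|k IH] cf.
  by move=> x Ux; apply: cvgV; [apply: f0|apply: cf].
have cf' := CkS cf; case: cf => [df Df]; split=> [x Ux|v].
  by apply: differentiableV; [apply: df|apply: f0].
apply: (eq_Ck _ (CkN (CkM (CkM (IH cf') (IH cf')) (Df v)))) => x Ux.
rewrite deriveV ?f0//; last by apply: diff_derivable; apply: df.
by rewrite scaleNr -expr2 exprVn.
Qed.

Lemma Ck_sqrt k (f : E -> R) : (forall x, U x -> 0 < f x) -> Ck k U f ->
  Ck k U (fun x => Num.sqrt (f x)).
Proof.
move=> f0; elim: k => [|k IH] cf.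
  by move=> x Ux; apply: continuous_comp; [apply: cf|apply: sqrt_continuous].
have cf' := CkS cf; case: cf => [df Df].
have ds x : U x -> differentiable (Num.sqrt : R -> R) (f x).
  by move=> Ux; apply/derivable1_diffP; have [] := is_derive1_sqrt (f0 x Ux).
split=> [x Ux|v].
  by apply: differentiable_comp; [apply: df|apply: ds].
have s0 x : U x -> 2 * Num.sqrt (f x) != 0.
  by move=> Ux; rewrite mulf_neq0 ?pnatr_eq0// gt_eqF// sqrtr_gt0 f0.
apply: (eq_Ck _ (CkM (Df v) (CkV s0 (CkM (Ck_cst k (2 : R)) (IH cf'))))) => x Ux.
have dfx := df x Ux; have dsx := ds x Ux.
have dcx : differentiable (Num.sqrt \o f : E -> R) x by exact: differentiable_comp.
rewrite (deriveE _ dfx) (deriveE _ dcx) (diff_comp dfx dsx).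
rewrite /= deriv1E/=; last by have [] := is_derive1_sqrt (f0 x Ux).
by rewrite derive1E derive_sqrt ?f0.
Qed.

Lemma Ck_linear (F : normedModType R) k (f : {linear E -> F}) :
  continuous f -> Ck k U f.
Proof.
move=> cf; case: k => [|k]; first by move=> x _; apply: cf.
split=> [x _|v]; first exact: linear_differentiable.
apply: (eq_Ck _ (Ck_cst k (f v))) => x _.
by rewrite deriveE ?diff_lin//; exact: linear_differentiable.
Qed.

End FixedDomain.

Lemma Ck_subset (E F : normedModType R) (U V : set E) k (f : E -> F) :
  V `<=` U -> Ck k U f -> Ck k V f.
Proof.
move=> VU; elim: k f => [|k IH] f; first by move=> cf x /VU; apply: cf.
by move=> [df Df]; split=> [x /VU|v]; [apply: df|apply: IH; apply: Df].
Qed.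

(** One open set serves all orders, and [f] itself, not a local extension of it, is smooth there. *)
Definition smooth_at (E F : normedModType R) (x : E) (f : E -> F) :=
  exists U : set E, [/\ open U, U x & forall k, Ck k U f].

Lemma smooth_at_smooth_on (E F : normedModType R) (X : set E) (f : E -> F) :
  (forall x, X x -> smooth_at x f) -> smooth_on X f.
Proof.
by move=> sf x Xx; have [U [oU Ux cU]] := sf x Xx; exists U, f; split.
Qed.

Section SmoothAt.
Variables (E : normedModType R) (x : E).

Lemma smooth_at_cst (F : normedModType R) (a : F) : smooth_at x (fun=> a).
Proof. by exists setT; split=> [|//|k]; [exact: openT|apply: Ck_cst; exact: openT]. Qed.

Lemma smooth_atD (F : normedModType R) (f g : E -> F) :
  smooth_at x f -> smooth_at x g -> smooth_at x (fun y => f y + g y).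
Proof.
move=> [U [oU Ux cU]] [V [oV Vx cV]]; exists (U `&` V); split=> // [|k].
  exact: openI.
by apply: CkD; [exact: openI|apply: Ck_subset (cU k)|apply: Ck_subset (cV k)] => y [].
Qed.

Lemma smooth_atM (f g : E -> R) :
  smooth_at x f -> smooth_at x g -> smooth_at x (fun y => f y * g y).
Proof.
move=> [U [oU Ux cU]] [V [oV Vx cV]]; exists (U `&` V); split=> // [|k].
  exact: openI.
by apply: CkM; [exact: openI|apply: Ck_subset (cU k)|apply: Ck_subset (cV k)] => y [].
Qed.

Lemma smooth_atZl (F : normedModType R) (f : E -> R) (a : F) :
  smooth_at x f -> smooth_at x (fun y => f y *: a).
Proof. by move=> [U [oU Ux cU]]; exists U; split=> // k; apply: CkZl. Qed.

Lemma smooth_atN (f : E -> R) : smooth_at x f -> smooth_at x (fun y => - f y).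
Proof. by move=> [U [oU Ux cU]]; exists U; split=> // k; apply: CkN. Qed.

Lemma smooth_atB (f g : E -> R) :
  smooth_at x f -> smooth_at x g -> smooth_at x (fun y => f y - g y).
Proof. by move=> sf sg; apply: smooth_atD => //; apply: smooth_atN. Qed.

Lemma open_preimageI (U : set E) (f : E -> R) (A : set R) :
  open U -> (forall y, U y -> {for y, continuous f}) -> open A ->
  open (U `&` f @^-1` A).
Proof.
move=> oU cf oA; rewrite openE => y [Uy Ay].
apply: filterI; first exact: open_nbhs_nbhs.
by apply: (cf y Uy); apply: open_nbhs_nbhs.
Qed.

Lemma smooth_atV (f : E -> R) : f x != 0 -> smooth_at x f ->
  smooth_at x (fun y => (f y)^-1).
Proof.
move=> f0 [U [oU Ux cU]]; pose V := U `&` f @^-1` [set r | r != 0].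
have c0 : forall y, U y -> {for y, continuous f} := cU 0%N.
have oV : open V by apply: (open_preimageI oU c0); exact: open_neq.
exists V; split=> // k; apply: CkV => // [y [] //|].
by apply: Ck_subset (cU k) => y [].
Qed.

Lemma smooth_at_div (f g : E -> R) : g x != 0 ->
  smooth_at x f -> smooth_at x g -> smooth_at x (fun y => f y / g y).
Proof. by move=> g0 sf sg; apply: smooth_atM => //; apply: smooth_atV. Qed.

Lemma smooth_at_sqrt (f : E -> R) : 0 < f x -> smooth_at x f ->
  smooth_at x (fun y => Num.sqrt (f y)).
Proof.
move=> f0 [U [oU Ux cU]]; pose V := U `&` f @^-1` [set r | 0 < r].
have c0 : forall y, U y -> {for y, continuous f} := cU 0%N.
have oV : open V by apply: (open_preimageI oU c0); exact: open_gt.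
exists V; split=> // k; apply: Ck_sqrt => // [y [] //|].
by apply: Ck_subset (cU k) => y [].
Qed.

Lemma smooth_at_sum (F : normedModType R) (J : Type) (r : seq J) (P : pred J)
    (f : J -> E -> F) : (forall j, P j -> smooth_at x (f j)) ->
  smooth_at x (fun y => \sum_(j <- r | P j) f j y).
Proof.
move=> sf; elim: r => [|j r IH].
  have -> : (fun y => \sum_(j <- [::] | P j) f j y) = fun=> 0.
    by apply/funext => y; rewrite big_nil.
  exact: smooth_at_cst.
have -> : (fun y => \sum_(j <- j :: r | P j) f j y) = fun y =>
  if P j then f j y + \sum_(j <- r | P j) f j y else \sum_(j <- r | P j) f j y.
  by apply/funext => y; rewrite big_cons.
by case Pj: (P j) => //; apply: smooth_atD => //; apply: sf.
Qed.

Lemma smooth_at_linear (F : normedModType R) (f : {linear E -> F}) :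
  continuous f -> smooth_at x f.
Proof. by move=> cf; exists setT; split=> [|//|k]; [exact: openT|apply: Ck_linear => //; exact: openT]. Qed.

Lemma smooth_at_mx p q (f : E -> 'M[R]_(p, q)) :
  (forall i j, smooth_at x (fun y => f y i j)) -> smooth_at x f.
Proof.
move=> sf.
have -> : f = fun y => \sum_i \sum_j f y i j *: delta_mx i j.
  by apply/funext => y; apply: matrix_sum_delta.
apply: smooth_at_sum => i _; apply: smooth_at_sum => j _; exact: smooth_atZl.
Qed.

Lemma smooth_at_pair_mx p q p' q' (f : E -> 'M[R]_(p, q)) (g : E -> 'M[R]_(p', q')) :
  (forall i j, smooth_at x (fun y => f y i j)) ->
  (forall i j, smooth_at x (fun y => g y i j)) ->
  smooth_at x (fun y => (f y, g y)).
Proof.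
move=> sf sg.
have -> : (fun y => (f y, g y)) = fun y =>
    \sum_i \sum_j f y i j *: (delta_mx i j, 0 : 'M[R]_(p', q')) +
    \sum_i \sum_j g y i j *: (0 : 'M[R]_(p, q), delta_mx i j).
  apply/funext => y; rewrite [LHS]surjective_pairing [RHS]surjective_pairing.
  congr pair.
    rewrite (raddfD (@fst _ _)) !(raddf_sum (@fst _ _)) /=.
    rewrite [X in _ = _ + X]big1 ?addr0 => [|i _]; last first.
      by rewrite (raddf_sum (@fst _ _)) big1// => j _; rewrite /= scaler0.
    rewrite [LHS]matrix_sum_delta; apply: eq_bigr => i _.
    by rewrite (raddf_sum (@fst _ _)).
  rewrite (raddfD (@snd _ _)) !(raddf_sum (@snd _ _)) /=.
  rewrite [X in _ = X + _]big1 ?add0r => [|i _]; last first.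
    by rewrite (raddf_sum (@snd _ _)) big1// => j _; rewrite /= scaler0.
  rewrite [LHS]matrix_sum_delta; apply: eq_bigr => i _.
  by rewrite (raddf_sum (@snd _ _)).
apply: smooth_atD; apply: smooth_at_sum => i _; apply: smooth_at_sum => j _;
  exact: smooth_atZl.
Qed.


End SmoothAt.

Lemma smooth_at_linear_fun (E : normedModType R) (f : E -> R) (x : E) :
  linear (f : E -> R^o) -> continuous f -> smooth_at x f.
Proof.
move=> flin cf; pose fM := GRing.isLinear.Build _ _ _ _ _ flin.
pose fL : {linear E -> R^o} := HB.pack f fM.
exact: (@smooth_at_linear _ x _ fL).
Qed.

Lemma smooth_at_coord p q i j (x : 'M[R]_(p, q)) :
  smooth_at x (fun M : 'M[R]_(p, q) => M i j).
Proof.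
apply: smooth_at_linear_fun; last exact: coord_continuous.
by move=> a u v; rewrite !mxE.
Qed.

Lemma smooth_at_fst_coord p q i j (F : normedModType R) (x : 'M[R]_(p, q) * F) :
  smooth_at x (fun M : 'M[R]_(p, q) * F => M.1 i j).
Proof.
apply: smooth_at_linear_fun; first by move=> a u v; rewrite !mxE.
move=> M; apply: (@continuous_comp _ _ _ fst (fun u : 'M[R]_(p, q) => u i j)).
  exact: cvg_fst.
exact: coord_continuous.
Qed.

End SmoothFunctions.

(** * A diffeomorphism between the open unit ball and the box of parameters *)

Section BallBox.
Variables (R : realType) (d : nat).
Local Notation vec := ('I_d -> R).

(** Ball and box are compared through the whole space. The ball is opened radially by
    [x / sqrt (1 - |x|^2)]; each coordinate is then closed by the inverse of this map in dimension
    one, rescaled from the interval between -1 and 1 to that between 0 and 1. *)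
Definition ball_to_space (x : 'rV[R]_d) : vec :=
  fun k => x ord0 k / Num.sqrt (1 - \sum_i x ord0 i ^+ 2).
Definition space_to_ball (y : vec) : 'rV[R]_d :=
  \row_k (y k / Num.sqrt (1 + \sum_i y i ^+ 2)).
Definition space_to_box (y : vec) : vec :=
  fun k => (1 + y k / Num.sqrt (1 + y k ^+ 2)) / 2.
Definition box_to_space (t : vec) : vec :=
  fun k => (2 * t k - 1) / Num.sqrt (1 - (2 * t k - 1) ^+ 2).

Definition ball_to_box x := space_to_box (ball_to_space x).
Definition box_to_ball t := space_to_ball (box_to_space t).

Lemma sumsq_ge0 (I : finType) (y : I -> R) : 0 <= \sum_i y i ^+ 2.
Proof. by apply: sumr_ge0 => i _; apply: sqr_ge0. Qed.

Lemma sumsq_div (I : finType) (y : I -> R) (r : R) :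
  \sum_i (y i / r) ^+ 2 = (\sum_i y i ^+ 2) / r ^+ 2.
Proof. by rewrite mulr_suml; apply: eq_bigr => i _; rewrite expr_div_n. Qed.

Lemma ball_to_spaceK x : open_unit_ball x -> space_to_ball (ball_to_space x) = x.
Proof.
rewrite /open_unit_ball /= -subr_gt0 => x1; apply/rowP => k.
rewrite mxE /ball_to_space sumsq_div.
set S := \sum_i _ in x1 *; rewrite sqr_sqrtr ?ltW//.
have -> : 1 + S / (1 - S) = (1 - S)^-1 by field; rewrite gt_eqF.
by rewrite sqrtrV ?ltW// invrK divfK// gt_eqF// sqrtr_gt0.
Qed.

Lemma space_to_ball_in y : open_unit_ball (space_to_ball y).
Proof.
have S0 := sumsq_ge0 y.
have S1 : 0 < 1 + \sum_i y i ^+ 2 by rewrite ltr_pwDl.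
rewrite /open_unit_ball /=; under eq_bigr do rewrite mxE.
by rewrite sumsq_div sqr_sqrtr ?ltW// ltr_pdivrMr// mul1r ltrDr.
Qed.

Lemma space_to_ballK y : ball_to_space (space_to_ball y) = y.
Proof.
have S0 := sumsq_ge0 y.
have S1 : 0 < 1 + \sum_i y i ^+ 2 by rewrite ltr_pwDl.
apply/funext => k; rewrite /ball_to_space.
under eq_bigr do rewrite mxE.
rewrite mxE sumsq_div sqr_sqrtr ?ltW//; set S := \sum_i _ in S0 S1 *.
have -> : 1 - S / (1 + S) = (1 + S)^-1 by field; rewrite gt_eqF.
by rewrite sqrtrV ?ltW// invrK divfK// gt_eqF// sqrtr_gt0.
Qed.

Lemma space_to_boxK y : box_to_space (space_to_box y) = y.
Proof.
apply/funext => k; rewrite /box_to_space /space_to_box.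
have S1 : 0 < 1 + y k ^+ 2 by rewrite ltr_pwDl ?sqr_ge0.
have s1 : 0 < Num.sqrt (1 + y k ^+ 2) by rewrite sqrtr_gt0.
have -> (u : R) : 2 * ((1 + u) / 2) - 1 = u by field.
rewrite expr_div_n sqr_sqrtr ?ltW//.
have -> : 1 - y k ^+ 2 / (1 + y k ^+ 2) = (1 + y k ^+ 2)^-1 by field; rewrite gt_eqF.
by rewrite sqrtrV ?ltW// invrK divfK// gt_eqF.
Qed.

Lemma box_sqr_lt1 (t : R) : 0 < t < 1 -> 0 < 1 - (2 * t - 1) ^+ 2.
Proof. by move=> /andP[t0 t1]; nra. Qed.

Lemma box_to_spaceK t : (forall k, 0 < t k < 1) -> space_to_box (box_to_space t) = t.
Proof.
move=> t01; apply/funext => k; rewrite /space_to_box /box_to_space.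
have := box_sqr_lt1 (t01 k); set v := 2 * t k - 1 => v1.
have s1 : 0 < Num.sqrt (1 - v ^+ 2) by rewrite sqrtr_gt0.
rewrite expr_div_n sqr_sqrtr ?ltW//.
have -> : 1 + v ^+ 2 / (1 - v ^+ 2) = (1 - v ^+ 2)^-1 by field; rewrite gt_eqF.
by rewrite sqrtrV ?ltW// invrK divfK ?gt_eqF// /v; field.
Qed.

Lemma space_to_box_in y k : 0 < space_to_box y k < 1.
Proof.
rewrite /space_to_box; set u := y k / _.
have S1 : 0 < 1 + y k ^+ 2 by rewrite ltr_pwDl ?sqr_ge0.
have : u ^+ 2 < 1.
  by rewrite /u expr_div_n sqr_sqrtr ?ltW// ltr_pdivrMr// mul1r ltrDr.
by rewrite -subr_gt0 => u1; apply/andP; split; nra.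
Qed.

Lemma smooth_at_ball_to_box x k : open_unit_ball x ->
  smooth_at x (fun z => ball_to_box z k).
Proof.
move=> x1; rewrite /ball_to_box /space_to_box /ball_to_space.
have s1 (F : normedModType R) (a : F) : smooth_at x (fun=> a) by exact: smooth_at_cst.
have sc i : smooth_at x (fun z => z ord0 i) by exact: smooth_at_coord.
have sS : smooth_at x (fun z : 'rV[R]_d => 1 - \sum_i z ord0 i ^+ 2).
  by apply: smooth_atB => //; apply: smooth_at_sum => i _; apply: smooth_atM.
have sy : smooth_at x (fun z : 'rV[R]_d =>
    z ord0 k / Num.sqrt (1 - \sum_i z ord0 i ^+ 2)).
  have p1 : 0 < 1 - \sum_i x ord0 i ^+ 2 by rewrite subr_gt0.
  apply: smooth_at_div => //; first by rewrite gt_eqF// sqrtr_gt0.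
  exact: smooth_at_sqrt.
apply: smooth_atM => //; apply: smooth_atD => //.
set y := fun z : 'rV[R]_d => _ in sy *.
have p1 : 0 < 1 + y x ^+ 2 by rewrite ltr_pwDl ?sqr_ge0.
apply: smooth_at_div => //; first by rewrite gt_eqF// sqrtr_gt0.
by apply: smooth_at_sqrt => //; apply: smooth_atD => //; apply: smooth_atM.
Qed.

(** Stated for box coordinates that depend on a point of a normed space, since [param_inv] reads
    them off a pair of matrices. *)
Lemma smooth_at_box_to_ball (E : normedModType R) (z : E) (t : E -> vec) :
  (forall k, 0 < t z k < 1) -> (forall k, smooth_at z (t^~ k)) ->
  smooth_at z (fun y => box_to_ball (t y)).
Proof.
move=> t01 st; apply: smooth_at_mx => i k.
have s1 (F : normedModType R) (a : F) : smooth_at z (fun=> a) by exact: smooth_at_cst.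
have sv j : smooth_at z (fun y => 2 * t y j - 1).
  by apply: smooth_atB => //; apply: smooth_atM.
have sy j : smooth_at z (fun y => box_to_space (t y) j).
  have p1 := box_sqr_lt1 (t01 j).
  apply: smooth_at_div => //; first by rewrite gt_eqF// sqrtr_gt0.
  by apply: smooth_at_sqrt => //; apply: smooth_atB => //; apply: smooth_atM.
have -> : (fun y => box_to_ball (t y) i k) = fun y =>
    box_to_space (t y) k / Num.sqrt (1 + \sum_j box_to_space (t y) j ^+ 2).
  by apply/funext => y; rewrite mxE.
have p1 : 0 < 1 + \sum_j box_to_space (t z) j ^+ 2 by rewrite ltr_pwDl ?sumsq_ge0.
apply: smooth_at_div => //; first by rewrite gt_eqF// sqrtr_gt0.
apply: smooth_at_sqrt => //; apply: smooth_atD => //.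
by apply: smooth_at_sum => j _; apply: smooth_atM.
Qed.

End BallBox.

(** * Smooth dependence of the recurrence coefficients on the weights *)

Section SmoothOrthogonal.
Variables (R : realType) (E : normedModType R) (z : E).
Variables (I : finType) (xi : I -> R) (A : {set I}) (w : E -> I -> R).
Hypothesis xi_inj : injective xi.
Hypothesis w_gt0 : forall i, i \in A -> 0 < w z i.
Hypothesis w_smooth : forall i, smooth_at z (w^~ i).

Lemma smooth_at_wdot (f g : E -> {poly R}) :
  (forall x, smooth_at z (fun y => (f y).[x])) ->
  (forall x, smooth_at z (fun y => (g y).[x])) ->
  smooth_at z (fun y => wdot xi A (w y) (f y) (g y)).
Proof.
move=> sf sg; apply: smooth_at_sum => i _.
by apply: smooth_atM => //; apply: smooth_atM.
Qed.

Lemma smooth_at_hornerXM (f : E -> {poly R}) :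
  (forall x, smooth_at z (fun y => (f y).[x])) ->
  forall x, smooth_at z (fun y => ('X * f y).[x]).
Proof.
move=> sf x; have -> : (fun y => ('X * f y).[x]) = fun y => x * (f y).[x].
  by apply/funext => y; rewrite !hornerE.
by apply: smooth_atM => //; apply: smooth_at_cst.
Qed.

Let orth_smooth k := forall x, smooth_at z (fun y => (orth xi A (w y) k).[x]).

Lemma smooth_at_jalpha k : (k < #|A|)%N -> orth_smooth k ->
  smooth_at z (fun y => jalpha xi A (w y) k).
Proof.
move=> kA so; apply: smooth_at_div.
- by rewrite gt_eqF// orth_norm_gt0.
- by apply: smooth_at_wdot => //; apply: smooth_at_hornerXM.
- exact: smooth_at_wdot.
Qed.

Lemma smooth_at_orth0 : orth_smooth 0.
Proof. by move=> x; exact: smooth_at_cst. Qed.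

Lemma smooth_at_jbeta k : (k < #|A|)%N -> (forall j, (j <= k)%N -> orth_smooth j) ->
  smooth_at z (fun y => jbeta xi A (w y) k).
Proof.
case: k => [|k] kA so.
  have -> : (fun y => jbeta xi A (w y) 0) = fun y =>
      wdot xi A (w y) (orth xi A (w y) 0) (orth xi A (w y) 0).
    by apply/funext => y; rewrite jbeta0.
  by apply: smooth_at_wdot; exact: smooth_at_orth0.
have -> : (fun y => jbeta xi A (w y) k.+1) = fun y =>
   wdot xi A (w y) (orth xi A (w y) k.+1) (orth xi A (w y) k.+1) /
   wdot xi A (w y) (orth xi A (w y) k) (orth xi A (w y) k).
  by apply/funext => y; rewrite jbetaS.
apply: smooth_at_div.
- by rewrite gt_eqF// orth_norm_gt0// ltnW.
- by apply: smooth_at_wdot; apply: so.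
- by apply: smooth_at_wdot; apply: so.
Qed.

Lemma smooth_at_orth k : (k <= #|A|)%N -> orth_smooth k.
Proof.
elim/ltn_ind: k => -[|[|k]] IH kA x; first exact: smooth_at_orth0.
  have -> : (fun y => (orth xi A (w y) 1).[x]) = fun y => x - jalpha xi A (w y) 0.
    by apply/funext => y; rewrite orth1 hornerXsubC.
  apply: smooth_atB; first exact: smooth_at_cst.
  by apply: smooth_at_jalpha => //; exact: smooth_at_orth0.
have -> : (fun y => (orth xi A (w y) k.+2).[x]) = fun y =>
  (x - jalpha xi A (w y) k.+1) * (orth xi A (w y) k.+1).[x] -
   jbeta xi A (w y) k.+1 * (orth xi A (w y) k).[x].
  by apply/funext => y; rewrite orthSS hornerD hornerN !hornerM hornerXsubC hornerC.
have IHk j : (j <= k.+1)%N -> orth_smooth j.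
  by move=> jk; apply: IH => //; apply: leq_trans jk (ltnW kA).
apply: smooth_atB; apply: smooth_atM; [|exact: IHk| |exact: IHk].
  apply: smooth_atB; first exact: smooth_at_cst.
  by apply: smooth_at_jalpha => //; apply: IHk.
exact: smooth_at_jbeta.
Qed.

Lemma smooth_at_jcoefs m k : (k < m)%N -> (m <= #|A|)%N ->
  smooth_at z (fun y => (nth (0, 0) (jcoefs xi A (w y) m) k).1) /\
  smooth_at z (fun y => (nth (0, 0) (jcoefs xi A (w y) m) k).2).
Proof.
move=> km mA; have kA := leq_trans km mA.
split.
  have -> : (fun y => (nth (0, 0) (jcoefs xi A (w y) m) k).1) =
     fun y => jalpha xi A (w y) k by apply/funext => y; rewrite nth_mkseq.
  by apply: smooth_at_jalpha => //; apply: smooth_at_orth; apply: ltnW.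
have -> : (fun y => (nth (0, 0) (jcoefs xi A (w y) m) k).2) =
   fun y => jbeta xi A (w y) k by apply/funext => y; rewrite nth_mkseq.
apply: smooth_at_jbeta => // j jk; apply: smooth_at_orth.
exact: leq_trans jk (ltnW kA).
Qed.

End SmoothOrthogonal.

(** * The components are balls *)

Section SmoothHalves.
Variables (R : realType) (N : nat) (F : normedModType R).
Variable z : 'M[R]_N.+1 * F.

(** These values are polynomials in the entries of the matrix, which makes [param_inv] smooth on the
    ambient space near a component. *)
Lemma smooth_at_left_list x k :
  smooth_at z (fun JJ : 'M[R]_N.+1 * F =>
    (jden (left_list (diag_of JJ.1) (offdiag_of JJ.1) k)).[x]) /\
  smooth_at z (fun JJ : 'M[R]_N.+1 * F =>
    (jnum (left_list (diag_of JJ.1) (offdiag_of JJ.1) k)).[x]).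
Proof.
elim: k => [|k [IHd IHn]].
  by split; exact: smooth_at_cst.
split.
  have -> : (fun JJ : 'M[R]_N.+1 * F =>
      (jden (left_list (diag_of JJ.1) (offdiag_of JJ.1) k.+1)).[x]) = fun JJ =>
      (x - JJ.1 (inord k) (inord k)) *
      (jden (left_list (diag_of JJ.1) (offdiag_of JJ.1) k)).[x] -
      (jnum (left_list (diag_of JJ.1) (offdiag_of JJ.1) k)).[x].
    apply/funext => JJ; rewrite /= jden_cons.
    by rewrite hornerD hornerN hornerM hornerXsubC.
  apply: smooth_atB => //; apply: smooth_atM => //.
  by apply: smooth_atB; [exact: smooth_at_cst|exact: smooth_at_fst_coord].
have -> : (fun JJ : 'M[R]_N.+1 * F =>
    (jnum (left_list (diag_of JJ.1) (offdiag_of JJ.1) k.+1)).[x]) = fun JJ =>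
    JJ.1 (inord k) (inord k.+1) * JJ.1 (inord k) (inord k.+1) *
    (jden (left_list (diag_of JJ.1) (offdiag_of JJ.1) k)).[x].
  by apply/funext => JJ; rewrite /= jnum_cons hornerM hornerC.
by apply: smooth_atM => //; apply: smooth_atM; exact: smooth_at_fst_coord.
Qed.

End SmoothHalves.

Section ComponentBalls.
Local Open Scope classical_set_scope.
Variables (R : realType) (n m d s : nat).
Local Notation I := ('I_d + 'I_s)%type.
Variables (xi c : I -> R) (a0 theta M : R).
Hypothesis xi_inj : injective xi.
Hypothesis c_gt0 : forall i, 0 < c i.
Hypothesis nmE : (n + m = d + d + s)%N.
Local Notation mat := 'M[R]_((n + m).+1).

Definition with_perturbation (J : mat) : mat * mat :=
  (J, perturbation (inord n) theta M J).

Definition param (T : {set 'I_s}) (x : 'rV[R]_d) : mat * mat :=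
  with_perturbation (model n m xi c a0 T (ball_to_box x)).

(** By [jnum_left_model], the left numerator at a double zero is the parameter [t k] times the
    denominator used here. *)
Definition param_inv (T : {set 'I_s}) (JJ : mat * mat) : 'rV[R]_d :=
  box_to_ball (fun k => (jnum (left_half JJ.1)).[xi (inl k)] /
    (c (inl k) * (cofactor_at xi (left_nodes d T) (inl k)).[xi (inl k)])).

Definition component T := param T @` @open_unit_ball R d.

Section OneComponent.
Variable T : {set 'I_s}.
Hypothesis cardT : (d + #|T|)%N = n.

Lemma ball_to_box_in x (k : 'I_d) : 0 < @ball_to_box R d x k < 1.
Proof. exact: space_to_box_in. Qed.

Lemma param_inv_box x k :
  (jnum (left_half (param T x).1)).[xi (inl k)] /
    (c (inl k) * (cofactor_at xi (left_nodes d T) (inl k)).[xi (inl k)]) =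
  ball_to_box x k.
Proof.
rewrite jnum_left_model//; last exact: ball_to_box_in.
by rewrite -mulrA mulfK// mulf_neq0 ?(cofactor_at_neq0 xi_inj) ?gt_eqF.
Qed.

Lemma paramK x : open_unit_ball x -> param_inv T (param T x) = x.
Proof.
move=> x1; rewrite /param_inv.
under eq_fun do rewrite param_inv_box.
by rewrite /box_to_ball space_to_boxK ball_to_spaceK.
Qed.

Lemma smooth_at_model x i j : open_unit_ball x ->
  smooth_at x (fun y => model n m xi c a0 T (ball_to_box y) i j).
Proof.
move=> x1; have st k : smooth_at x (fun y => ball_to_box y k).
  exact: smooth_at_ball_to_box.
have swl k : smooth_at x (fun y => left_weight c (ball_to_box y) k).
  case: k => k /=; last exact: smooth_at_cst.
  by apply: smooth_atM => //; exact: smooth_at_cst.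
have swr k : smooth_at x (fun y => right_weight c (ball_to_box y) k).
  case: k => k /=; last exact: smooth_at_cst.
  apply: smooth_atM; last exact: smooth_at_cst.
  by apply: smooth_atB => //; exact: smooth_at_cst.
have t01 := ball_to_box_in x.
have cl : #|left_nodes d T| = n by rewrite card_left_nodes.
have cr : #|left_nodes d (~: T)%SET| = m by exact: card_right_nodes nmE _ cardT.
have l0 k : k \in left_nodes d T -> 0 < left_weight c (ball_to_box x) k.
  by move=> _; exact: left_weight_gt0.
have r0 k : k \in left_nodes d (~: T)%SET -> 0 < right_weight c (ball_to_box x) k.
  by move=> _; exact: right_weight_gt0.
have sl k (kn : (k < n)%N) :=
  smooth_at_jcoefs xi_inj l0 swl kn (eq_leq (esym cl)).
have sr k (kn : (k < m)%N) :=
  smooth_at_jcoefs xi_inj r0 swr kn (eq_leq (esym cr)).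
have [szl /(all_nthP (0, 0)) bl _ _] := jfrac_model_left xi_inj c_gt0 cardT t01.
have [szr /(all_nthP (0, 0)) br _ _] := jfrac_model_right xi_inj c_gt0 nmE cardT t01.
rewrite szl in bl; rewrite szr in br.
have sdiag k : (k < (n + m).+1)%N -> smooth_at x (fun y =>
    glue_diag n (jcoefs xi (left_nodes d T) (left_weight c (ball_to_box y)) n) a0
      (jcoefs xi (left_nodes d (~: T)%SET) (right_weight c (ball_to_box y)) m) k).
  move=> kN; rewrite /glue_diag; case kn : (k < n)%N.
    by have [] := sl (n - k.+1)%N _; first lia.
  case: (k == n) / (eqVneq k n) => [kn'|kn']; first exact: smooth_at_cst.
  by have [] := sr (k - n.+1)%N _; first lia.
have soff k : (k < n + m)%N -> smooth_at x (fun y =>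
    glue_offdiag n (jcoefs xi (left_nodes d T) (left_weight c (ball_to_box y)) n)
      (jcoefs xi (left_nodes d (~: T)%SET) (right_weight c (ball_to_box y)) m) k).
  move=> kN; apply: smooth_atN; case kn : (k < n)%N.
    have lt : (n - k.+1 < n)%N by lia.
    by apply: smooth_at_sqrt; [exact: bl|have [] := sl _ lt].
  have lt : (k - n < m)%N by lia.
  by apply: smooth_at_sqrt; [exact: br|have [] := sr _ lt].
have -> : (fun y => model n m xi c a0 T (ball_to_box y) i j) = fun y =>
  if i == j :> nat then
    glue_diag n (jcoefs xi (left_nodes d T) (left_weight c (ball_to_box y)) n) a0
      (jcoefs xi (left_nodes d (~: T)%SET) (right_weight c (ball_to_box y)) m) i
  else if j == i.+1 :> nat then
    glue_offdiag n (jcoefs xi (left_nodes d T) (left_weight c (ball_to_box y)) n)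
      (jcoefs xi (left_nodes d (~: T)%SET) (right_weight c (ball_to_box y)) m) i
  else if i == j.+1 :> nat then
    glue_offdiag n (jcoefs xi (left_nodes d T) (left_weight c (ball_to_box y)) n)
      (jcoefs xi (left_nodes d (~: T)%SET) (right_weight c (ball_to_box y)) m) j
  else 0.
  by apply/funext => y; rewrite mxE.
have := ltn_ord i; have := ltn_ord j => jN iN.
case: (i == j :> nat); first exact: sdiag.
case ji : (j == i.+1 :> nat); first by apply: soff; lia.
case ij : (i == j.+1 :> nat); first by apply: soff; lia.
exact: smooth_at_cst.
Qed.

Lemma smooth_at_param x : open_unit_ball x -> smooth_at x (param T).
Proof.
move=> x1; have sJ i j := smooth_at_model i j x1.
apply: smooth_at_pair_mx => // i j.
have sc (a : R) : smooth_at x (fun=> a) by exact: smooth_at_cst.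
have -> : (fun y => perturbation (inord n) theta M
    (model n m xi c a0 T (ball_to_box y)) i j) = fun y =>
  if (i == inord n) && (j == inord n) then
    theta ^+ 2 * (model n m xi c a0 T (ball_to_box y) (inord n) (inord n) + M)
  else if (i == inord n) || (j == inord n) then
    theta * model n m xi c a0 T (ball_to_box y) i j
  else model n m xi c a0 T (ball_to_box y) i j.
  by apply/funext => y; rewrite mxE.
case: (_ && _); first by apply: smooth_atM => //; apply: smooth_atD.
by case: (_ || _) => //; apply: smooth_atM.
Qed.

(** Around points of the component [param_inv] is given by a formula that is smooth in the ambient
    space, so it is its own local extension. *)
Lemma component_ball : diffeomorphic (component T) (@open_unit_ball R d).
Proof.
exists (param_inv T), (param T); split.
- apply: smooth_at_smooth_on => _ [x x1 <-].
  apply: smooth_at_box_to_ball => k.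
    by rewrite param_inv_box; exact: ball_to_box_in.
  apply: smooth_at_div; last exact: smooth_at_cst.
    by rewrite mulf_neq0 ?(cofactor_at_neq0 xi_inj) ?gt_eqF.
  exact: (smooth_at_left_list _ _ _).2.
- by apply: smooth_at_smooth_on => x; exact: smooth_at_param.
- by move=> _ [x x1 <-]; rewrite paramK.
- by move=> x x1; split; [exists x|exact: paramK].
Qed.

(** [T] can be read off any member, so different [T] give disjoint components. *)
Lemma component_root JJ j : component T JJ ->
  root (jden (left_half JJ.1)) (xi (inr j)) = (j \in T).
Proof.
move=> [x _ <-]; rewrite /param /= jden_left_model// ?root_nodal_xi ?inE//.
exact: ball_to_box_in.
Qed.

End OneComponent.

Lemma open_unit_ball_open : open (@open_unit_ball R d).
Proof.
have -> : @open_unit_ball R d =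
    setT `&` (fun x : 'rV[R]_d => \sum_i x ord0 i ^+ 2) @^-1` [set r | r < 1].
  by rewrite setTI.
apply: open_preimageI; [exact: openT| |exact: open_lt].
move=> x _.
have [U [_ Ux /(_ 0%N) cU]] : smooth_at x (fun x : 'rV[R]_d => \sum_i x ord0 i ^+ 2).
  by apply: smooth_at_sum => i _; apply: smooth_atM; exact: smooth_at_coord.
exact: cU.
Qed.

Lemma submanifold_of_ball (E : normedModType R) (S : set E) :
  diffeomorphic S (@open_unit_ball R d) -> submanifold d S.
Proof.
move=> dS x Sx; exists setT, (@open_unit_ball R d); split=> //.
- exact: openT.
- exact: open_unit_ball_open.
- by rewrite setIT.
Qed.

Definition isospectral_set : set (mat * mat) :=
  [set JJ | [/\ jacobi JJ.1, JJ = with_perturbation JJ.1,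
     char_poly JJ.1 = full_poly xi c a0
   & jden (left_half JJ.1) * jden (right_half JJ.1) = minor_poly xi]].

Lemma isospectral_setE : isospectral_set =
  \bigcup_(T in [set T : {set 'I_s} | (d + #|T|)%N = n]) component T.
Proof.
apply/seteqP; split=> [[J J'] [/= jJ -> cJ qJ]|_ [T cT [x _ <-]]].
  have [T [t [cT t01 eJ]]] := model_onto xi_inj c_gt0 nmE jJ cJ qJ.
  exists T => //; exists (box_to_ball t); first exact: space_to_ball_in.
  by rewrite /param /ball_to_box /box_to_ball space_to_ballK box_to_spaceK// -eJ.
have [jJ cJ qJ] := model_spec a0 xi_inj c_gt0 nmE cT (ball_to_box_in x).
by split.
Qed.

(** The left half has [n] eigenvalues, [d] of which are double zeros; so [T] ranges over the subsets
    of size [n - d]. *)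
Lemma isospectral_set_balls : (d <= n)%N ->
  disjoint_union_of_balls d 'C(s, n - d) isospectral_set.
Proof.
move=> dn; pose D := [set T : {set 'I_s} | #|T| == (n - d)%N]%SET.
have cD : #|D| = 'C(s, n - d) by rewrite card_draws card_ord.
have DP (T : {set 'I_s}) : (d + #|T|)%N = n <-> T \in D.
  rewrite inE; split => [<-|/eqP->]; [by rewrite addKn|exact: subnKC].
exists (fun i => component (enum_val (cast_ord (esym cD) i))); split.
- by move=> i; apply/submanifold_of_ball/component_ball/DP/enum_valP.
- by move=> i; apply/component_ball/DP/enum_valP.
- move=> i j ij; rewrite -subset0 => JJ [] Ji Jj; apply/negP: ij.
  rewrite negbK; apply/eqP/(@cast_ord_inj _ _ (esym cD))/enum_val_inj.
  apply/setP => k; rewrite -(component_root _ _ Ji) ?(component_root _ _ Jj)//;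
  exact/DP/enum_valP.
- rewrite isospectral_setE; apply/seteqP; split=> JJ.
    move=> [T /DP TD JT]; exists (cast_ord cD (enum_rank_in TD T)); first by [].
    by rewrite cast_ordK enum_rankK_in.
  move=> [i _ Ji]; exists (enum_val (cast_ord (esym cD) i)) => //.
  exact/DP/enum_valP.
Qed.

End ComponentBalls.

(** * Cardinality of a disjoint union of balls *)

Section CountingBalls.
Local Open Scope classical_set_scope.
Variables (R : realType) (E : normedModType R).

Lemma open_unit_ball_infinite d : infinite_set (@open_unit_ball R d.+1).
Proof.
(* Coordinates of points on the first axis; the shift by 2 keeps them below 1. *)
pose h (j : nat) : R := j.+2%:R^-1.
move=> /(finite_image (fun x : 'rV[R]_d.+1 => x ord0 ord0)) fin.
apply: infinite_nat; suff : finite_set (range h).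
  rewrite (eq_finite_set (inj_card_eq _))// => i j _ _ /invr_inj/eqP.
  by rewrite eqr_nat => /eqP[].
apply: sub_finite_set fin => _ [j _ <-].
exists (\row_k (if k == ord0 then h j else 0)); last by rewrite mxE eqxx.
rewrite /open_unit_ball /= (bigD1 ord0)//= big1 => [|k /negbTE k0]; last first.
  by rewrite mxE k0 expr0n.
rewrite mxE eqxx addr0 /h exprVn invf_lt1 ?exprn_gt0//.
by rewrite -natrX ltr1n -[1%N]/(1 ^ 2)%N ltn_exp2r.
Qed.

Lemma disjoint_union_infinite d k (S : set E) : (0 < k)%N ->
  disjoint_union_of_balls d.+1 k S -> infinite_set S.
Proof.
case: k => // k _ [C [_ dC _ SE]] finS.
have [f [g [_ _ _ gP]]] := dC ord0.
apply: (@open_unit_ball_infinite d).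
apply: sub_finite_set (finite_image f finS) => y /gP[Cy <-].
by exists (g y) => //; rewrite SE; exists ord0.
Qed.

(** A ball of dimension 0 is a single point. *)
Lemma disjoint_union_of_points k (S : set E) :
  disjoint_union_of_balls 0 k S -> finite_set S /\ (S #= `I_k)%card.
Proof.
move=> [C [_ dC disj SE]].
suff cS : (S #= `I_k)%card by split=> //; apply/finite_setP; exists k.
have ex i : exists y, C i = [set y].
  have [f [g [_ _ fP gP]]] := dC i.
  have b0 : open_unit_ball (0 : 'rV[R]_0) by rewrite /open_unit_ball /= big_ord0.
  exists (g 0); apply/seteqP; split=> [y Cy|_ ->].
    by have [_ <-] := fP y Cy; rewrite [f y]thinmx0.
  by have [] := gP 0 b0.
have [h hP] := choice ex.
have -> : S = h @` [set: 'I_k].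
  rewrite SE; apply/seteqP; split=> [y [i _]|_ [i _ <-]].
    by rewrite hP => ->; exists i.
  by exists i => //; rewrite hP.
apply: card_eq_trans (inj_card_eq _) _; last by rewrite card_eq_sym; exact: card_II.
move=> i j _ _ hij; apply/eqP; apply: contraT => /disj.
by rewrite !hP hij setIid => e; have : (set0 : set E) (h j) by rewrite -e.
Qed.

End CountingBalls.

(** * From the spectra to the two polynomials *)

Section InterlacingRoots.
Variable R : rcfType.

Lemma poly_root_between (p : {poly R}) (a b : R) : a < b -> p.[a] * p.[b] < 0 ->
  exists2 x, a < x < b & root p x.
Proof.
move=> ab pab.
have wlogp (q : {poly R}) : q.[a] < 0 -> 0 < q.[b] ->
    exists2 x, a < x < b & root q x.
  move=> qa qb; have q0 : q.[a] <= 0 <= q.[b] by rewrite !ltW.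
  have [x /andP[ax xb] rx] := poly_ivt (ltW ab) q0.
  exists x => //; rewrite !lt_def ax xb !andbT; apply/andP; split.
    by apply: contraTneq rx => ->; rewrite rootE lt_eqF.
  by apply: contraTneq rx => <-; rewrite rootE gt_eqF.
have [pa|pa|pa] := ltgtP p.[a] 0.
- by apply: wlogp => //; move: pab; rewrite nmulr_rlt0.
- have [x xab rx] : exists2 x, a < x < b & root (- p) x.
    apply: wlogp; rewrite hornerN ?oppr_lt0// oppr_gt0.
    by move: pab; rewrite pmulr_rlt0.
  by exists x => //; rewrite rootN in rx.
- by move: pab; rewrite pa mul0r ltxx.
Qed.

(** The value at a node is [w i] times its cofactor, and the cofactors at consecutive nodes have
    opposite signs; so each of the [r] gaps contains a zero. *)
Lemma nodal_num_roots r (la : 'I_r.+1 -> R) (w : 'I_r.+1 -> R) :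
  (forall i j : 'I_r.+1, (i < j)%N -> la i < la j) -> (forall i, 0 < w i) ->
  exists rho : seq R, [/\ size rho = r, uniq rho
    & all (root (nodal_num la finset.setT w)) rho].
Proof.
move=> la_incr w0; set p := nodal_num _ _ _.
have la_inj : injective la.
  move=> i j e; apply/val_inj; apply: contraTeq isT => /=.
  by rewrite neq_ltn => /orP[] /la_incr; rewrite e ltxx.
have nxt (k : 'I_r) : (k.+1 < r.+1)%N by rewrite ltnS.
have cur (k : 'I_r) : (k < r.+1)%N by rewrite ltnW.
have ex (k : 'I_r) : exists x,
    la (Ordinal (cur k)) < x < la (Ordinal (nxt k)) /\ root p x.
  set i := Ordinal (cur k); set j := Ordinal (nxt k).
  have ij : la i < la j by apply: la_incr.
  suff pij : p.[la i] * p.[la j] < 0.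
    by have [x xij rx] := poly_root_between ij pij; exists x.
  rewrite !horner_nodal_num ?inE// mulrACA pmulr_rlt0 ?mulr_gt0//.
  have nij : i != j by rewrite -val_eqE /= ltn_eqF.
  rewrite /cofactor_at (bigD1 j) ?inE 1?eq_sym//=.
  rewrite [X in _ * X.[_]](bigD1 i) ?inE//=.
  rewrite !hornerM !hornerXsubC mulrACA.
  (* The two nodes contribute a negative product to the cofactors of each other; any other node lies
     on the same side of both and contributes a positive one. *)
  rewrite nmulr_rlt0; last by rewrite nmulr_rlt0 ?subr_lt0// subr_gt0.
  rewrite (eq_bigl (fun k => (k \in finset.setT) && (k != j) && (k != i))); last first.
    by move=> l; rewrite -!andbA [(l != i) && _]andbC.
  rewrite !horner_prod -big_split /=; apply: prodr_gt0 => l /andP[/andP[_ lj] li].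
  rewrite !hornerXsubC; have [lti|gti] := ltnP l i.
    by rewrite mulr_gt0// subr_gt0 la_incr//= ltnW.
  have ltj : (j < l)%N by move: gti li lj; rewrite -!val_eqE /=; lia.
  by rewrite nmulr_rgt0 subr_lt0 la_incr//=; move: ltj; rewrite /=; lia.
have [rho rhoP] := choice ex.
have rho_incr (k l : 'I_r) : (k < l)%N -> rho k < rho l.
  move=> kl; have [/andP[_ rk] _] := rhoP k; have [/andP[rl _] _] := rhoP l.
  apply: lt_trans rk (le_lt_trans _ rl).
  have [e|ne] := eqVneq k.+1 l; last by rewrite ltW// la_incr//=; lia.
  by rewrite (_ : Ordinal (nxt k) = Ordinal (cur l))//; apply/val_inj.
exists (codom rho); split; first by rewrite size_codom card_ord.
  apply/injectiveP => k l e; apply/val_inj; apply: contraTeq isT => /=.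
  by rewrite neq_ltn => /orP[] /rho_incr; rewrite e ltxx.
by apply/allP => _ /codomP[k ->]; have [_] := rhoP k.
Qed.

End InterlacingRoots.

Section InterlacingData.
Variable R : realType.

Lemma prod_XsubC_nth (s : seq R) r (x0 : R) : size s = r ->
  \prod_(z <- s) ('X - z%:P) = nodal (fun k : 'I_r => nth x0 s k) finset.setT.
Proof.
move=> <-; rewrite (big_nth x0) big_mkord /nodal; apply: eq_bigl => k.
by rewrite inE.
Qed.

Lemma deriv_prod_XsubC_neq0 (s : seq R) z : uniq s -> z \in s ->
  (\prod_(x <- s) ('X - x%:P))^`().[z] != 0.
Proof.
move=> us zs; have [k ks <-] := nthP 0 zs.
rewrite (prod_XsubC_nth 0 (erefl (size s))) -[k]/(nat_of_ord (Ordinal ks)).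
rewrite (@horner_deriv_nodal _ _ (fun k : 'I_(size s) => nth 0 s k)) ?inE//.
apply: (@cofactor_at_neq0 _ _ (fun k : 'I_(size s) => nth 0 s k)).
by move=> i j /eqP; rewrite nth_uniq// => /eqP/val_inj.
Qed.

(* [D] collects the common zeros of [Q] and [P]; [P1 = P / D] and [Q1 = Q / D]
   interlace strictly, and the zeros of [D] are among those of [Q1] because
   they are double zeros of [Q]. *)
Lemma interlacing_data (s : seq R) (Q : {poly R}) :
  let P := \prod_(z <- s) ('X - z%:P) in
  let d := count (root Q) s in
  sorted <%R s -> Q \is monic -> size Q = size s ->
  (forall z, z \in s -> 0 <= Q.[z] * P^`().[z]) ->
  (forall z, z \in s -> root Q z -> root Q^`() z) ->
  exists (ss : nat) (xi c : 'I_d + 'I_ss -> R) (a0 : R),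
  [/\ injective xi, forall i, 0 < c i, (size s).-1 = (d + d + ss)%N,
     minor_poly xi = Q & full_poly xi c a0 = P].
Proof.
move=> P d srt mQ szQ sgnQ dblQ.
have us : uniq s := lt_sorted_uniq srt.
pose Z := [seq z <- s | root Q z]; pose S := [seq z <- s | predC (root Q) z].
have szZ : size Z = d by rewrite size_filter.
have sZS : perm_eq (Z ++ S) s by rewrite perm_filterC.
have srtS : sorted <%R S by apply: sorted_filter srt; exact: lt_trans.
have uZ : uniq Z by exact: filter_uniq.
have uS : uniq S by exact: filter_uniq.
pose D := \prod_(z <- Z) ('X - z%:P); pose P1 := \prod_(z <- S) ('X - z%:P).
have PE : P = D * P1 by rewrite /P -(perm_big _ sZS) big_cat.
have mD : D \is monic := monic_prod_XsubC _ _ _.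
have szD : size D = d.+1 by rewrite size_prod_XsubC szZ.
have [Q1 QE] : exists Q1, Q = D * Q1.
  have rZ : all (root Q) Z by apply/allP => z; rewrite mem_filter => /andP[].
  have urZ : uniq_roots Z by rewrite uniq_rootsE.
  by have [q ->] := uniq_roots_prod_XsubC rZ urZ; exists q; rewrite mulrC.
have mQ1 : Q1 \is monic by rewrite -(monicMl _ mD) -QE.
have szs : size s = (d + size S)%N by rewrite -(perm_size sZS) size_cat szZ.
have szQ1 : size Q1 = size S.
  have := szQ; rewrite QE size_monicM ?monic_neq0// szD szs addSn /=.
  by move=> /eqP; rewrite eqn_add2l => /eqP.
have : (0 < size S)%N by rewrite -szQ1 size_poly_gt0 monic_neq0.
case eS : (size S) => [//|r] _.
pose la (k : 'I_r.+1) := nth 0 S k.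
have laS k : la k \in S by rewrite mem_nth// eS.
have la_incr (i j : 'I_r.+1) : (i < j)%N -> la i < la j.
  by move=> ij; rewrite (lt_sorted_ltn_nth 0 srtS) ?inE ?eS.
have la_inj : injective la.
  by move=> i j /eqP; rewrite nth_uniq ?eS// => /eqP/val_inj.
have P1E : P1 = nodal la finset.setT := prod_XsubC_nth 0 eS.
(* The residues of [Q1 / P1] at the zeros of [P1]. *)
pose w k := Q1.[la k] / (cofactor_at la finset.setT k).[la k].
have Q1E : Q1 = nodal_num la finset.setT w.
  by apply: nodal_numE => //; rewrite cardsT card_ord szQ1 eS.
have w0 k : 0 < w k.
  have := laS k; rewrite mem_filter => /andP[/= nr ks].
  have cE : P1^`().[la k] = (cofactor_at la finset.setT k).[la k].
    by rewrite P1E horner_deriv_nodal ?inE.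
  have := sgnQ _ ks; rewrite PE QE derivM hornerD !hornerM.
  have /rootP-> : root P1 (la k) by rewrite P1E root_nodal_xi ?inE.
  rewrite mulr0 add0r mulrACA => ge0.
  move: nr; rewrite QE rootM negb_or !rootE => /andP[D0 Q10].
  have c0 := cofactor_at_neq0 la_inj finset.setT k.
  (* The factor [D] enters the sign hypothesis squared and can be divided out. *)
  move: ge0; rewrite pmulr_rge0; last by rewrite -expr2 lt_def sqr_ge0 sqrf_eq0 D0.
  rewrite cE /w => ge0.
  by rewrite div_gt0_mul// lt_def ge0 mulf_neq0.
(* Positive residues give [Q1] as many real zeros as its degree, so it splits. *)
have [rho [szrho urho rrho]] := nodal_num_roots la_incr w0.
rewrite -Q1E in rrho.
have Q1rho : Q1 = \prod_(z <- rho) ('X - z%:P).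
  have sz1 : size Q1 = (size rho).+1 by rewrite szQ1 eS szrho.
  have ur : uniq_roots rho by rewrite uniq_rootsE.
  by rewrite [LHS](all_roots_prod_XsubC sz1 rrho ur) (eqP mQ1) scale1r.
(* The zeros of [D] are simple, so a double zero of [Q = D * Q1] at one of them is also a zero of
   [Q1]. *)
have Zrho z : z \in Z -> z \in rho.
  move=> zZ; rewrite -(root_prod_XsubC rho z) -Q1rho.
  have zs : z \in s by move: zZ; rewrite mem_filter => /andP[].
  have rz : root Q z by move: zZ; rewrite mem_filter => /andP[].
  have /rootP := dblQ z zs rz; rewrite QE derivM hornerD !hornerM.
  have /rootP Dz : root D z by rewrite root_prod_XsubC.
  rewrite Dz mul0r addr0 => /eqP; rewrite mulf_eq0 => /orP[|//] D'0.
  have := deriv_prod_XsubC_neq0 uZ zZ; rewrite -/D.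
  by rewrite D'0.
pose W := [seq x <- rho | x \notin Z].
have rhoE : perm_eq (Z ++ W) rho.
  rewrite (perm_trans _ (permEl (perm_filterC (mem Z) rho)))// perm_cat2r.
  apply: uniq_perm => //; first exact: filter_uniq.
  by move=> x; rewrite mem_filter /=; apply/idP/andP => [xZ|[]//]; split=> //; apply: Zrho.
have uZW : uniq (Z ++ W) by rewrite (perm_uniq rhoE).
have szW : (d + size W)%N = r by rewrite -szZ -size_cat (perm_size rhoE).
pose ss := size W.
pose xi (i : 'I_d + 'I_ss) : R := match i with inl k => nth 0 Z k | inr j => nth 0 W j end.
have xi_inj : injective xi.
  have xiE i : xi i = nth 0 (Z ++ W) (match i with inl k => k : nat | inr j => (d + j)%N end).
    case: i => k /=; rewrite nth_cat szZ; first by rewrite ltn_ord.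
    by rewrite ltnNge leq_addr /= addKn.
  move=> i j; rewrite !xiE => /eqP; rewrite nth_uniq ?size_cat ?szZ//; last 2 first.
  - by case: (i) => k; [rewrite ltn_addr|rewrite ltn_add2l].
  - by case: (j) => k; [rewrite ltn_addr|rewrite ltn_add2l].
  case: i => i; case: j => j /eqP.
  - by move/val_inj ->.
  - by move=> e; have := ltn_ord i; rewrite e ltnNge leq_addr.
  - by move=> e; have := ltn_ord j; rewrite -e ltnNge leq_addr.
  - by move/addnI/val_inj ->.
have commonE : nodal xi (common d ss) = D.
  rewrite nodal_sum (eq_bigl xpredT) => [|k]; last by rewrite inE.
  rewrite [X in _ * X]big1 ?mulr1 => [|k]; last by rewrite inE.
  by rewrite /D (prod_XsubC_nth 0 szZ) /nodal; apply: eq_bigl => k; rewrite inE.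
have allE : nodal xi finset.setT = Q1.
  rewrite nodal_sum Q1rho -(perm_big _ rhoE) big_cat /=; congr (_ * _).
    by rewrite (prod_XsubC_nth 0 szZ) /nodal; apply: eq_bigl => k; rewrite !inE.
  by rewrite (prod_XsubC_nth 0 (erefl ss)) /nodal; apply: eq_bigl => k; rewrite !inE.
have wr x : root Q1 x -> 0 < - (P1.[x] * Q1^`().[x]).
  have ne : (0 < #|[set: 'I_r.+1]%SET|)%N by rewrite cardsT card_ord.
  move=> /rootP rx; have := nodal_num_wronskian la_inj x (fun k _ => w0 k) ne.
  rewrite -Q1E -P1E /wronskian.
  by rewrite hornerD hornerN !hornerM rx mulr0 add0r.
have rxi i : root Q1 (xi i) by rewrite -allE root_nodal_xi ?inE.
pose cof i := (cofactor_at xi finset.setT i).[xi i].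
have cofE i : cof i = Q1^`().[xi i] by rewrite -allE horner_deriv_nodal ?inE.
have cof0 i : cof i != 0 by exact: cofactor_at_neq0.
(* The residues of [- P1 / Q1]; their sign comes from the Wronskian at a zero of [Q1]. *)
pose c i := - P1.[xi i] / cof i.
have c0 i : 0 < c i.
  by rewrite /c div_gt0_mul// mulNr cofE wr.
have szP1 : size P1 = r.+2 by rewrite size_prod_XsubC eS.
have mP1 : P1 \is monic := monic_prod_XsubC _ _ _.
(* ['X * Q1] and [P1] are monic of degree [r.+1]; this choice cancels the coefficient of degree [r]
   as well. *)
pose a0 := ('X * Q1 - P1)`_r.
have szR : (size (('X - a0%:P) * Q1 - P1)%R <= r)%N.
  apply/leq_sizeP => j rj; rewrite mulrBl !coefB coefXM coefCM.
  have cP1 : P1`_r.+1 = 1 by rewrite -(eqP mP1) lead_coefE szP1.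
  have cQ1 : Q1`_r = 1 by rewrite -(eqP mQ1) lead_coefE szQ1 eS.
  move: rj; rewrite leq_eqVlt => /predU1P[<-|].
    rewrite /a0 coefB coefXM cQ1; case: ifP => _; ring.
  rewrite leq_eqVlt => /predU1P[<-|rj].
    rewrite /= cQ1 cP1 [Q1`_r.+1]nth_default ?szQ1 ?eS//; ring.
  rewrite [P1`_j]nth_default ?szP1// [Q1`_j]nth_default ?szQ1 ?eS 1?ltnW//.
  rewrite [Q1`_j.-1]nth_default ?szQ1 ?eS; last by case: (j) rj.
  by rewrite if_same; ring.
have RE : ('X - a0%:P) * Q1 - P1 = nodal_num xi finset.setT c.
  rewrite [LHS](nodal_numE xi_inj (A := finset.setT)); last first.
    by rewrite cardsT card_sum !card_ord szW.
  apply: eq_nodal_num => i _; rewrite hornerD hornerM hornerN (rootP (rxi i)).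
  by rewrite mulr0 add0r.
exists ss, xi, c, a0; split=> //.
- by rewrite szs eS addnS /= -szW addnA.
- by rewrite /minor_poly commonE allE QE mulrC.
- rewrite /full_poly /minor_poly commonE allE -RE PE; ring.
Qed.

End InterlacingData.

(** * Pairing the two spectra *)

Section Pairing.
Variables (R : realType) (N : nat) (sigma sigmah : N.-tuple R) (K : R) (p : nat).
Hypothesis srt : sorted <%R sigma.
Hypothesis usigmah : uniq sigmah.
Hypothesis hpN : (p <= N)%N.
Hypothesis hp : (lam sigma p < K%:E)%E /\ (K%:E <= lam sigma p.+1)%E.
Hypothesis hI : condI sigma sigmah K p.
Hypothesis hK : K \in sigma -> K \in sigmah.

Lemma unique_in_ex (I : interval (\bar R)) : unique_in sigmah I ->
  exists2 x, x \in sigmah & x%:E \in I.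
Proof.
move=> cI; have : has (fun x => x%:E \in I) sigmah by rewrite has_count cI.
by move/hasP.
Qed.

Lemma lamE j : (0 < j <= N)%N -> lam sigma j = (sigma`_j.-1)%:E.
Proof. by move=> /andP[j0 jN]; rewrite /lam gtn_eqF// jN. Qed.

Lemma sigma_lt i j : (i < j)%N -> (j < N)%N -> sigma`_i < sigma`_j.
Proof.
move=> ij jN; rewrite (lt_sorted_ltn_nth 0 srt) ?inE ?size_tuple//.
exact: ltn_trans jN.
Qed.

Lemma sigma_le i j : (i <= j)%N -> (j < N)%N -> sigma`_i <= sigma`_j.
Proof.
by rewrite leq_eqVlt => /predU1P[->//|ij jN]; rewrite ltW// sigma_lt.
Qed.

Lemma sigma_lt_K i : (i < p)%N -> sigma`_i < K.
Proof.
move=> ip; have [+ _] := hp; rewrite lamE ?(leq_ltn_trans _ ip)// lte_fin.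
by apply: le_lt_trans; apply: sigma_le; case: (p) ip hpN.
Qed.

Lemma K_le_sigma i : (p <= i)%N -> (i < N)%N -> K <= sigma`_i.
Proof.
move=> pi iN; have [_] := hp; rewrite lamE /= ?(leq_ltn_trans pi)// lee_fin.
by move=> /le_trans; apply; apply: sigma_le.
Qed.

(** Tuples are indexed from 0, so entry [j] of [sigma] is lambda_(j+1). Eigenvalues below [K] find
    their partner to the right, the others to the left. *)
Lemma eigenvalue_pairing_ex (j : 'I_N) : exists2 x, x \in sigmah &
  if (j < p)%N then sigma`_j <= x < K /\ ((j.+1 < p)%N -> x < sigma`_j.+1)
  else K <= x <= sigma`_j /\ ((p < j)%N -> sigma`_j.-1 < x).
Proof.
have [h1 h2 h3 h4] := hI; have jN := ltn_ord j.
have [jp|pj] := ltnP j p.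
  have [jp1|] := ltnP j.+1 p.
    have /h1/unique_in_ex[x xs] : (1 <= j.+1 <= p - 1)%N.
      by move: jp1; clear; lia.
    rewrite in_itv /= !lamE ?(leq_trans _ hpN) ?(ltnW jp1)//= lee_fin lte_fin.
    move=> /andP[sx xs']; exists x => //; rewrite sx; split=> //.
    by apply: lt_trans xs' (sigma_lt_K jp1).
  move=> pj1; have pE : p = j.+1 by apply/eqP; rewrite eqn_leq pj1 jp.
  have /h3/unique_in_ex[x xs] : (1 <= p)%N by rewrite pE.
  rewrite in_itv /= pE lamE//= lee_fin lte_fin => sxK.
  by exists x => //; rewrite sxK ltnn; split.
move: pj; rewrite leq_eqVlt => /predU1P[pE|pj].
  have : K <= sigma`_j by rewrite K_le_sigma// pE.
  rewrite le_eqVlt => /predU1P[KE|Klt].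
    (* The interval from [K] to lambda_(p+1) is empty here, and [K], a common eigenvalue, is its own
       partner. *)
    exists K; first by apply: hK; rewrite KE mem_nth ?size_tuple.
    by rewrite lexx KE lexx pE ltnn; split.
  have pN : (p <= N - 1)%N by move: pE jN; clear; lia.
  have /(h4 pN)/unique_in_ex[x xs] : (K%:E < lam sigma p.+1)%E.
    by rewrite lamE pE//= lte_fin.
  rewrite in_itv /= lamE pE//= lee_fin lte_fin => /andP[Kx xs'].
  by exists x => //; rewrite (ltW Kx) xs' ltnn; split.
have /h2/unique_in_ex[x xs] : (p + 1 <= j <= N - 1)%N.
  by move: pj jN; clear; lia.
rewrite in_itv /= !lamE ?(leq_ltn_trans _ pj) ?(ltnW jN)//= lee_fin lte_fin.
move=> /andP[sx xs']; exists x => //; rewrite xs' andbT; split=> //.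
apply: ltW; apply: le_lt_trans sx; apply: K_le_sigma; case: (nat_of_ord j) pj jN => // k pk kN.
exact: ltnW.
Qed.

(* [f i] is the perturbed eigenvalue lying between [lambda_i] and [K]. *)
Lemma eigenvalue_pairing : exists f : 'I_N -> R,
  [/\ perm_eq sigmah (codom f),
      forall i j : 'I_N, i != j -> 0 <= (sigma`_j - f i) * (sigma`_j - sigma`_i)
    & forall j : 'I_N, 0 <= (sigma`_j - f j) * (sigma`_j - K)].
Proof.
have /choice[f fP] : forall j : 'I_N, exists x, x \in sigmah /\
    if (j < p)%N then sigma`_j <= x < K /\ ((j.+1 < p)%N -> x < sigma`_j.+1)
    else K <= x <= sigma`_j /\ ((p < j)%N -> sigma`_j.-1 < x).
  by move=> j; have [x xs Px] := eigenvalue_pairing_ex j; exists x.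
have above (i j : 'I_N) : (i < j)%N -> f i < sigma`_j.
  move=> ij; have [_] := fP i; have jN := ltn_ord j.
  case: ifPn => ip [/andP[h1 h2] h3]; last exact: le_lt_trans h2 (sigma_lt ij jN).
  have [ip1|] := ltnP i.+1 p; first exact: lt_le_trans (h3 ip1) (sigma_le ij jN).
  by move=> pi; apply: lt_le_trans h2 (K_le_sigma (leq_trans pi ij) jN).
have below (i j : 'I_N) : (j < i)%N -> sigma`_j < f i.
  move=> ji; have [_] := fP i; have iN := ltn_ord i.
  case: ifPn => ip [/andP[h1 h2] h3]; first exact: lt_le_trans (sigma_lt ji iN) h1.
  have [pi|] := ltnP p i.
    apply: le_lt_trans (h3 pi); apply: sigma_le; last exact: leq_ltn_trans (leq_pred _) iN.
    by case: (nat_of_ord i) ji.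
  by move=> ip'; apply: lt_le_trans (sigma_lt_K (leq_trans ji ip')) h1.
have f_incr (i j : 'I_N) : (i < j)%N -> f i < f j.
  move=> ij; have [_] := fP i; have [_] := fP j.
  case: ifPn => jp [/andP[h1 h2] h3].
    by move=> _; apply: lt_le_trans (above _ _ ij) h1.
  case: ifPn => ip [/andP[g1 g2] g3]; first exact: lt_le_trans g2 h1.
  exact: le_lt_trans g2 (below _ _ ij).
exists f; split.
(* [f] is strictly increasing with [N] values in [sigmah], so it enumerates [sigmah]. *)
- have uf : uniq (codom f).
    apply/injectiveP => i j e; apply/val_inj; apply: contraTeq isT => /=.
    by rewrite neq_ltn => /orP[] /f_incr; rewrite e ltxx.
  have sub : {subset codom f <= sigmah} by move=> _ /codomP[i ->]; have [] := fP i.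
  rewrite perm_sym; apply: uniq_perm => //.
  have sz : (size sigmah <= size (codom f))%N.
    by rewrite size_tuple size_codom card_ord.
  exact: (uniq_min_size uf sub sz).2.
- move=> i j; rewrite neq_ltn => /orP[ij|ji].
    by rewrite mulr_ge0// subr_ge0 ltW ?above ?sigma_lt.
  by rewrite mulr_le0// subr_le0 ltW ?below ?sigma_lt.
- move=> j; have [_] := fP j; case: ifPn => jp [/andP[h1 h2] _].
    by rewrite mulr_le0// subr_le0// ltW// sigma_lt_K.
  by rewrite mulr_ge0// subr_ge0// K_le_sigma// leqNgt.
Qed.

End Pairing.

(** * The minor [Q] as a quotient of a combination of the spectral polynomials *)

Section MinorFromSpectra.
Variables (R : realType) (N : nat) (sigma sigmah : N.-tuple R) (K th2 : R).
Hypothesis usigma : uniq sigma.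
Hypothesis th01 : 0 < th2 < 1.
Hypothesis hmu : forall mu, mu \in mus sigma sigmah K -> th2 = Nhat sigma sigmah mu.

Let P := spec_poly sigma.
Let Ph := spec_poly sigmah.
Let g := gcdp Ph P.
Let num := Nhat_num sigma sigmah.
Let den := Nhat_den sigma sigmah.
(** The numerator of [Nhat - th2]; conditions on the values of [Nhat] become conditions on the zeros
    of [H]. *)
Let H := num - th2%:P * den.

Lemma Nhat_numK : num * g = Ph.
Proof. by rewrite divpK// dvdp_gcdl. Qed.

Lemma Nhat_denK : den * g = P.
Proof. by rewrite divpK// dvdp_gcdr. Qed.

Lemma spec_poly_combE : Ph - th2%:P * P = H * g.
Proof. by rewrite /H mulrBl -mulrA Nhat_numK Nhat_denK. Qed.

Lemma root_spec_poly (s : N.-tuple R) x : root (spec_poly s) x = (x \in s).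
Proof. exact: root_prod_XsubC. Qed.

Lemma deriv_spec_poly_neq0 z : z \in sigma -> P^`().[z] != 0.
Proof. exact: deriv_prod_XsubC_neq0. Qed.

(** The zeros of [P] are simple: at a common eigenvalue [g] takes the zero and none is left for
    [den], so [Nhat] is finite there. *)
Lemma common_eigenvalue z : z \in sigma -> z \in sigmah ->
  [/\ g.[z] = 0, g^`().[z] != 0, den.[z] != 0 & P^`().[z] = den.[z] * g^`().[z]].
Proof.
move=> zs zsh; have gz : g.[z] = 0.
  by apply/rootP; rewrite root_gcd !root_spec_poly zs zsh.
have P'E : P^`().[z] = den.[z] * g^`().[z].
  by rewrite -Nhat_denK derivM hornerD !hornerM gz mulr0 add0r.
have := deriv_spec_poly_neq0 zs; rewrite P'E mulf_eq0 negb_or => /andP[d0 g0].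
by split.
Qed.

Lemma horner_H z : den.[z] != 0 -> H.[z] = (Nhat sigma sigmah z - th2) * den.[z].
Proof.
by move=> d0; rewrite /H /Nhat hornerD hornerN hornerM hornerC mulrBl divfK.
Qed.

Lemma minor_exists : root (Ph - th2%:P * P) K ->
  exists Q, (1 - th2)%:P * ('X - K%:P) * Q = Ph - th2%:P * P.
Proof.
have [t0 t1] := andP th01.
move/factor_theorem => [q ->]; exists ((1 - th2)^-1%:P * q).
have e : (1 - th2)%:P * (1 - th2)^-1%:P = 1 :> {poly R}.
  by rewrite -polyCM divff ?subr_eq0 ?gt_eqF.
transitivity (((1 - th2)%:P * (1 - th2)^-1%:P) * (q * ('X - K%:P))); first by ring.
by rewrite e mul1r.
Qed.

Variable Q : {poly R}.
Hypothesis QE : (1 - th2)%:P * ('X - K%:P) * Q = Ph - th2%:P * P.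

Lemma minor_monic_size : Q \is monic /\ size Q = N.
Proof.
have [t0 t1] := andP th01; have t10 : 1 - th2 != 0 by rewrite subr_eq0 gt_eqF.
have szP : size P = N.+1 := size_spec_poly sigma.
have szPh : size Ph = N.+1 := size_spec_poly sigmah.
have cP : P`_N = 1.
  by have /eqP := spec_poly_monic sigma; rewrite lead_coefE -/P szP.
have cPh : Ph`_N = 1.
  by have /eqP := spec_poly_monic sigmah; rewrite lead_coefE -/Ph szPh.
have cL : (Ph - th2%:P * P)`_N = 1 - th2 by rewrite coefB coefCM cP cPh mulr1.
have szL : size (Ph - th2%:P * P) = N.+1.
  apply/eqP; rewrite eqn_leq; apply/andP; split.
    rewrite (leq_trans (size_polyD _ _))// size_polyN geq_max szPh leqnn /=.
    by rewrite mul_polyC (leq_trans (size_scale_leq _ _))// szP.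
  by rewrite ltnNge; apply: contra t10 => /leq_sizeP/(_ N (leqnn _)); rewrite cL => ->.
have Q0 : Q != 0.
  by apply/eqP => Q0; move: szL; rewrite -QE Q0 mulr0 size_poly0.
have szQ : size Q = N.
  move: szL; rewrite -QE -mulrA mul_polyC size_scale// size_monicM ?monicXsubC//.
  by rewrite size_XsubC => -[].
split=> //; rewrite monicE; apply/eqP/(mulfI t10).
have : lead_coef (Ph - th2%:P * P) = 1 - th2 by rewrite lead_coefE szL.
by rewrite -QE !lead_coefM lead_coefC lead_coefXsubC !mulr1.
Qed.

Lemma minor_at z : z \in sigma -> (1 - th2) * (z - K) * Q.[z] = Ph.[z].
Proof.
rewrite -root_spec_poly => /rootP zs.
have := congr1 (horner^~ z) QE; rewrite /= !(hornerM, hornerD, hornerN) zs.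
by rewrite !hornerC hornerX mulr0 subr0.
Qed.

Lemma root_minor z : z \in sigma -> z != K -> root Q z = (z \in sigmah).
Proof.
have [t0 t1] := andP th01.
move=> zs zK; rewrite -root_spec_poly rootE [RHS]rootE -/Ph -minor_at//.
by rewrite !mulf_eq0 !subr_eq0 (gt_eqF t1) (negbTE zK).
Qed.

Lemma minor_deriv z : z \in sigma -> z \in sigmah ->
  (1 - th2) * (Q.[z] + (z - K) * Q^`().[z]) = H.[z] * g^`().[z].
Proof.
move=> zs zsh; have [gz _ _ _] := common_eigenvalue zs zsh.
have := congr1 (fun p => p^`().[z]) QE; rewrite /= spec_poly_combE !poly.derivE.
rewrite !(hornerM, hornerD, hornerN) gz !hornerC !hornerX => e.
by rewrite mulr0 add0r in e; rewrite -e; ring.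
Qed.

(** Condition II makes [H] vanish at [z] along with [g], so [(X - K) Q] has a double zero there, all
    of it due to [Q] because [z] differs from [K]. *)
Lemma root_minor_deriv z : z \in sigma -> z != K -> root Q z -> root Q^`() z.
Proof.
have [t0 t1] := andP th01.
move=> zs zK rz; have zsh : z \in sigmah by rewrite -root_minor.
have [_ _ d0 _] := common_eigenvalue zs zsh.
have zmu : z \in mus sigma sigmah K by rewrite mem_filter zsh zK.
have := minor_deriv zs zsh; rewrite (rootP rz) add0r horner_H// -hmu// subrr !mul0r.
by move=> /eqP; rewrite !mulf_eq0 !subr_eq0 (gt_eqF t1) (negbTE zK) /= rootE.
Qed.

(* The zeros of the two polynomials are paired by [f] so that the paired factors
   have the same sign. *)
Lemma minor_sign z (f : 'I_N -> R) : perm_eq sigmah (codom f) ->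
  (forall i j : 'I_N, i != j -> 0 <= (sigma`_j - f i) * (sigma`_j - sigma`_i)) ->
  (forall j : 'I_N, 0 <= (sigma`_j - f j) * (sigma`_j - K)) ->
  z \in sigma -> z != K -> 0 <= Q.[z] * P^`().[z].
Proof.
have [t0 t1] := andP th01; have t10 : 0 < 1 - th2 by rewrite subr_gt0.
move=> pf fij fjK zs zK.
(* Multiplication by this positive number trades [Q] for [Ph], whose linear factors are known. *)
have zK2 : 0 < (1 - th2) * (z - K) ^+ 2.
  by rewrite mulr_gt0// lt_def sqr_ge0 sqrf_eq0 subr_eq0 zK.
rewrite -(pmulr_rge0 _ zK2).
have -> : (1 - th2) * (z - K) ^+ 2 * (Q.[z] * P^`().[z]) =
    (Ph.[z] * (z - K)) * P^`().[z] by rewrite -minor_at//; ring.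
have [k ks zE] := nthP 0 zs; rewrite size_tuple in ks.
pose j := Ordinal ks.
pose la (i : 'I_N) := sigma`_i.
have la_inj : injective la.
  by move=> i i' /eqP; rewrite nth_uniq ?size_tuple// => /eqP/val_inj.
have -> : P^`().[z] = \prod_(i < N | i != j) (z - sigma`_i).
  rewrite /P /spec_poly (prod_XsubC_nth 0 (size_tuple sigma)) -zE.
  rewrite -[k]/(nat_of_ord j) (@horner_deriv_nodal _ _ la) ?inE//.
  rewrite horner_prod; apply: eq_big => [i|i _]; first by rewrite inE.
  by rewrite hornerXsubC.
have -> : Ph.[z] = (z - f j) * \prod_(i < N | i != j) (z - f i).
  rewrite /Ph /spec_poly (perm_big _ pf) /= horner_prod big_map big_enum /=.
  by rewrite (bigD1 j)//= hornerXsubC; congr (_ * _); apply: eq_bigr => i _; rewrite hornerXsubC.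
have fac (a b c e : R) : a * b * c * e = (a * c) * (b * e) by ring.
rewrite fac -big_split mulr_ge0 -?zE ?(fjK j)//=.
by apply: prodr_ge0 => i ij; apply: (fij i j).
Qed.

End MinorFromSpectra.

(** * The minor at the point [K] *)

Section MinorAtK.
Variables (R : realType) (N : nat) (sigma sigmah : N.-tuple R) (K th2 : R).
Hypothesis usigma : uniq sigma.
Hypothesis th01 : 0 < th2 < 1.
Hypothesis Ksigma : K \in sigma.
Hypothesis Ksigmah : K \in sigmah.
Variable Q : {poly R}.
Hypothesis QE : (1 - th2)%:P * ('X - K%:P) * Q =
  spec_poly sigmah - th2%:P * spec_poly sigma.

Let P := spec_poly sigma.
Let g := gcdp (spec_poly sigmah) P.
Let num := Nhat_num sigma sigmah.
Let den := Nhat_den sigma sigmah.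
Let H := num - th2%:P * den.

(** At [K] one has [P' = den g'] and [(1 - th2) Q = H g'], so [r] is [P'^2 / (1 - th2)]. The sign of
    [Q P'] thus separates options IV a) and IV b). *)
Lemma minor_at_K : exists2 r : R, 0 < r &
  Q.[K] * P^`().[K] = (Nhat sigma sigmah K - th2) * r.
Proof.
have [t0 t1] := andP th01; have t10 : 0 < 1 - th2 by rewrite subr_gt0.
have [gK g'K dK P'K] := common_eigenvalue usigma Ksigma Ksigmah.
exists ((1 - th2)^-1 * (P^`().[K]) ^+ 2).
  by rewrite mulr_gt0 ?invr_gt0// lt_def sqr_ge0 sqrf_eq0 deriv_spec_poly_neq0.
have := minor_deriv usigma QE Ksigma Ksigmah; rewrite subrr mul0r addr0 horner_H//.
move=> e; apply: (mulfI (lt0r_neq0 t10)); rewrite mulrA e P'K; field.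
by rewrite gt_eqF.
Qed.

Lemma derive_Nhat : den.[K] != 0 -> derive1 (Nhat sigma sigmah) K =
  (num^`().[K] * den.[K] - num.[K] * den^`().[K]) / den.[K] ^+ 2.
Proof.
move=> dK.
have dn (p : {poly R}) : derivable (horner p) K 1 by exact: derivable_horner.
have De (p : {poly R}) : 'D_1 (horner p) K = p^`().[K].
  by have /(@derive_val _ _ _ _ _ _ _) := is_derive_poly p K.
have dV : derivable (fun x => (den.[x])^-1) K 1 by exact: derivableV.
rewrite derive1E (_ : Nhat sigma sigmah = horner num * (fun x => (den.[x])^-1)) //.
rewrite deriveM// deriveV// !De /=.
by rewrite /GRing.scale /=; field.
Qed.

(* [H] has a double zero at [K], so [(X - K) Q], which is proportional to
   [H g], has a triple one. *)
Lemma minor_deriv_at_K : Nhat sigma sigmah K = th2 ->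
  derive1 (Nhat sigma sigmah) K = 0 -> root Q K /\ root Q^`() K.
Proof.
have [t0 t1] := andP th01; have t10 : 1 - th2 != 0 by rewrite subr_eq0 gt_eqF.
move=> NK; have [gK g'K dK P'K] := common_eigenvalue usigma Ksigma Ksigmah.
rewrite derive_Nhat// => /eqP; rewrite mulf_eq0 invr_eq0 expf_eq0 (negbTE dK) orbF.
have numK : num.[K] = th2 * den.[K] by rewrite -NK /Nhat divfK.
rewrite numK [th2 * _]mulrC -mulrA mulrC -mulrBr mulf_eq0 (negbTE dK) /= => /eqP H'.
have HK : H.[K] = 0 by rewrite horner_H// NK subrr mul0r.
have H'K : H^`().[K] = 0.
  rewrite /H !poly.derivE !(hornerD, hornerN, hornerM) ?hornerC -[RHS]H'; ring.
have [h [hE hK h'K]] : exists h : {poly R}, [/\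
    (1 - th2)%:P * ('X - K%:P) * Q = h * gcdp (spec_poly sigmah) (spec_poly sigma),
    h.[K] = 0 & h^`().[K] = 0].
  by exists H; split=> //; rewrite QE spec_poly_combE.
(* At [K] the left side has first derivative [(1 - th2) Q] and second derivative [2 (1 - th2) Q'];
   those of the right side vanish, since [g], [h] and [h'] do. *)
have := congr1 (fun p => p^`()^`().[K]) hE.
have := congr1 (fun p => p^`().[K]) hE.
rewrite /= !poly.derivE !(hornerD, hornerN, hornerM) gK hK h'K !hornerC !hornerX.
rewrite !(subrr, mulr0, mul0r, addr0, add0r, mulr1, mul1r) => e1 e2.
split; rewrite rootE.
  by move/eqP: e1; rewrite mulf_eq0 (negbTE t10).
move/eqP: e2; rewrite -mulr2n mulrn_eq0 /= mulf_eq0 (negbTE t10).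
by [].
Qed.

End MinorAtK.

(** * The inverse family in terms of the minor *)

Section InverseFamily.
Local Open Scope classical_set_scope.
Variable R : realType.

(** With the first spectrum fixed, the perturbation identity converts the second one into the minor
    at [n], because the factor [(1 - th2) (X - K)] can be cancelled. *)
Lemma inverse_familyE (n m : nat) (sigma sigmah : ((n + m).+1).-tuple R)
    (K th2 : R) (Q : {poly R}) :
  uniq sigma -> uniq sigmah -> 0 < th2 < 1 ->
  (1 - th2)%:P * ('X - K%:P) * Q = spec_poly sigmah - th2%:P * spec_poly sigma ->
  inverse_family sigma sigmah K (inord n) th2 =
  [set JJ : 'M[R]_((n + m).+1) * 'M[R]_((n + m).+1) | [/\ jacobi JJ.1,
     JJ = with_perturbation (Num.sqrt th2) ((Num.sqrt th2 ^- 2 - 1) * K) JJ.1,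
     char_poly JJ.1 = spec_poly sigma
   & jden (left_half JJ.1) * jden (right_half JJ.1) = Q]].
Proof.
move=> us ush /andP[t0 t1] QE; set th := Num.sqrt th2.
have th0 : 0 < th by rewrite sqrtr_gt0.
have thE : th ^+ 2 = th2 by rewrite sqr_sqrtr// ltW.
have c0 : (1 - th2)%:P * ('X - K%:P) != 0.
  by rewrite mulf_neq0 ?polyXsubC_eq0// polyC_eq0 subr_eq0 gt_eqF.
apply/seteqP; split=> -[J J'] /=.
  move=> [[jJ jJ'] eJ /(spectrumP _ us) PJ /(spectrumP _ ush) PJ'].
  split=> //; first by rewrite /with_perturbation -eJ.
  have := char_poly_perturbation K jJ (lt0r_neq0 th0).
  rewrite -eJ PJ' PJ thE => e; apply: (mulfI c0).
  by rewrite QE e; ring.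
move=> [jJ [eJ] PJ JQ]; split.
- by split=> //; rewrite eJ; apply: perturbation_jacobi.
- exact: eJ.
- exact/spectrumP.
- apply/spectrumP => //; rewrite eJ char_poly_perturbation ?lt0r_neq0//.
  by rewrite thE JQ QE PJ; ring.
Qed.

Lemma inverse_family_balls (N : nat) (sigma sigmah : N.-tuple R)
    (K th2 : R) (n : 'I_N) (Q : {poly R}) :
  let d := count (root Q) sigma in
  sorted <%R sigma -> uniq sigmah -> 0 < th2 < 1 ->
  (1 - th2)%:P * ('X - K%:P) * Q = spec_poly sigmah - th2%:P * spec_poly sigma ->
  (forall z, z \in sigma -> 0 <= Q.[z] * (spec_poly sigma)^`().[z]) ->
  (forall z, z \in sigma -> root Q z -> root Q^`() z) ->
  (d <= ntilde n)%N ->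
  disjoint_union_of_balls d 'C(N - 2 * d - 1, n - d)
    (inverse_family sigma sigmah K n th2).
Proof.
move=> d srt ush th01 QE sgn dbl dn.
have us : uniq sigma := lt_sorted_uniq srt.
have [mQ szQ] := minor_monic_size th01 QE.
rewrite -[RHS](size_tuple sigma) in szQ.
have [ss [xi [c [a0 [xi_inj c0 szE QxE PxE]]]]] := interlacing_data srt mQ szQ sgn dbl.
rewrite -/d in xi c xi_inj c0 szE QxE PxE; clearbody d.
rewrite size_tuple in szE.
move: dn; rewrite /ntilde leq_min => /andP[dn dm].
(* [Q] has degree [N - 1] and [d] double zeros; the other zeros are simple. *)
have -> : (N - 2 * d - 1 = ss)%N by move: szE dn dm; clear; lia.
have [m NE] : exists m, N = (n + m).+1.
  by exists (N - n.+1)%N; rewrite -addSn subnKC.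
case: n dn dm NE => k kN /= dn dm NE; subst N.
have -> : Ordinal kN = inord k by apply/val_inj; rewrite /= inordK.
rewrite (inverse_familyE us ush th01 QE) -QxE -[spec_poly sigma]PxE.
exact: isospectral_set_balls.
Qed.

End InverseFamily.

Local Open Scope classical_set_scope.
Local Open Scope ring_scope.

(** * From conditions I)-IV) to the minor *)

Section MinorPolynomial.
Variables (R : realType) (N : nat) (sigma sigmah : N.-tuple R) (K : R) (n : 'I_N).
Variables (thetasq : R) (p : nat).
Hypothesis hsigma : sorted <%R sigma.
Hypothesis hsigmah : sorted <%R sigmah.
Hypothesis hpN : (p <= N)%N.
Hypothesis hp : (lam sigma p < K%:E)%E /\ (K%:E <= lam sigma p.+1)%E.
Hypothesis hI : condI sigma sigmah K p.
Hypothesis hII : condII sigma sigmah K thetasq.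
Hypothesis hIII : condIII sigma sigmah K n thetasq.
Hypothesis hIV : condIV sigma sigmah K n thetasq.

Let us : uniq sigma := lt_sorted_uniq hsigma.

Lemma K_common : (K \in sigma) || (K \in sigmah) -> (K \in sigma) /\ (K \in sigmah).
Proof. by move=> /hIV[/andP]. Qed.

(** If [K] belongs to a spectrum, it belongs to both and both polynomials vanish there; otherwise
    condition III says that [H] does. *)
Lemma root_comb_at_K : root (spec_poly sigmah - thetasq%:P * spec_poly sigma) K.
Proof.
have [Kin|Kout] := boolP ((K \in sigma) || (K \in sigmah)).
  have [Ks Ksh] := K_common Kin.
  move: Ks Ksh; rewrite -!root_spec_poly !rootE hornerD hornerN hornerM.
  by move=> /eqP-> /eqP->; rewrite mulr0 subrr.
have [_ NK] := hIII Kout; rewrite spec_poly_combE rootM; apply/orP; left.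
rewrite rootE horner_H ?NK ?subrr ?mul0r//.
move: Kout; rewrite negb_or -root_spec_poly -(Nhat_denK sigma sigmah) rootM negb_or.
by move=> /andP[/andP[]].
Qed.

(** Gathers what [inverse_family_balls] asks of [Q]. The last clause serves to count double zeros: a
    common eigenvalue [K] is one exactly when [Nhat] equals [thetasq] there. *)
Lemma minor_poly_spec : exists Q : {poly R},
  [/\ (1 - thetasq)%:P * ('X - K%:P) * Q =
        spec_poly sigmah - thetasq%:P * spec_poly sigma,
      forall z, z \in sigma -> 0 <= Q.[z] * (spec_poly sigma)^`().[z],
      forall z, z \in sigma -> root Q z -> root Q^`() z
    & forall z, z \in sigma -> root Q z =
        (z \in sigmah) && ((z != K) || (Nhat sigma sigmah K == thetasq))].
Proof.
have [hmu th01] := hII.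
have [Q QE] := minor_exists th01 root_comb_at_K.
have [f [pf fij fjK]] := eigenvalue_pairing hsigma (lt_sorted_uniq hsigmah) hpN
  hp hI (fun Ks => (K_common (introT orP (or_introl Ks))).2).
exists Q; split=> // z zs; have [zK|zK] := eqVneq z K.
- rewrite zK in zs *; have Kin : (K \in sigma) || (K \in sigmah) by rewrite zs.
  have [_ Ksh] := K_common Kin; have [r r0 ->] := minor_at_K us th01 zs Ksh QE.
  rewrite mulr_ge0 ?(ltW r0)// subr_ge0.
  by have [_ [[_ /ltW]|[_ ->]]] := hIV Kin.
- exact: (minor_sign us th01 QE pf fij fjK).
- rewrite zK in zs *; have Kin : (K \in sigma) || (K \in sigmah) by rewrite zs.
  have [_ Ksh] := K_common Kin.
  have [_ [[_ gt]|[_ NK dN]]] := hIV Kin.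
    have [r r0 e] := minor_at_K us th01 zs Ksh QE => /rootP QK.
    by move: e; rewrite QK mul0r => /esym/eqP; rewrite mulf_eq0 subr_eq0 !gt_eqF.
  by have [] := minor_deriv_at_K us th01 zs Ksh QE NK dN.
- exact: (root_minor_deriv us th01 hmu QE).
- rewrite zK in zs *; have Kin : (K \in sigma) || (K \in sigmah) by rewrite zs.
  have [_ Ksh] := K_common Kin; rewrite Ksh /=.
  have [r r0 e] := minor_at_K us th01 zs Ksh QE.
  have : (Q.[K] * (spec_poly sigma)^`().[K] == 0) = (Nhat sigma sigmah K == thetasq).
    by rewrite e mulf_eq0 subr_eq0 (gt_eqF r0) orbF.
  by rewrite mulf_eq0 (negbTE (deriv_spec_poly_neq0 us zs)) orbF.
- by rewrite andbT; apply: (root_minor th01 QE).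
Qed.

End MinorPolynomial.

Theorem theorem4 (R : realType) (N : nat) (hN : (2 <= N)%N)
  (sigma sigmah : N.-tuple R)
  (hsigma : sorted <%R sigma) (hsigmah : sorted <%R sigmah)
  (K : R) (n : 'I_N) (thetasq : R)
  (hthetasq : thetasq_spec sigma sigmah K thetasq)
  (p : nat) (hpN : (p <= N)%N)
  (hp : (lam sigma p < K%:E)%E /\ (K%:E <= lam sigma p.+1)%E)
  (hI : condI sigma sigmah K p)
  (hII : condII sigma sigmah K thetasq)
  (hIII : condIII sigma sigmah K n thetasq)
  (hIV : condIV sigma sigmah K n thetasq) :
  let q := qnum sigma sigmah K in
  let F := inverse_family sigma sigmah K n thetasq in
  let K_in_union := (K \in sigma) || (K \in sigmah) in
  (~~ K_in_union \/ (K_in_union /\ optionIVa sigma sigmah K n thetasq) ->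
     (q <> 0%N ->
        infinite_set F /\
        disjoint_union_of_balls q 'C(N - 2 * q - 1, n - q) F) /\
     (q = 0%N -> finite_set F /\ (F #= `I_('C(N - 1, n)))%card))
  /\
  (K_in_union /\ optionIVb sigma sigmah K n thetasq ->
     infinite_set F /\
     disjoint_union_of_balls q.+1 'C(N - 2 * q - 3, n - q - 1) F).
Proof.
move=> q F K_in_union.
have us : uniq sigma := lt_sorted_uniq hsigma.
have [Q [QE sgn dbl rootQ]] :=
  minor_poly_spec hsigma hsigmah hpN hp hI hII hIII hIV.
have [_ th01] := hII.
have := inverse_family_balls hsigma (lt_sorted_uniq hsigmah) th01 QE sgn dbl.
move=> /(_ n); set d := count (root Q) sigma; rewrite -/F => balls.
have qE : q = count (fun z => (z \in sigmah) && (z != K)) sigma.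
  by rewrite /q /qnum size_filter.
have nN := ltn_ord n.
(* At least one ball is needed for the family to be infinite. *)
have posbin e : (e <= ntilde n)%N -> (0 < 'C(N - 2 * e - 1, n - e))%N.
  by rewrite /ntilde leq_min bin_gt0 => /andP[]; move: nN; clear; lia.
split=> [cas|[Kin [qn NK _]]].
(* In both cases [K] is not among the double zeros, which are thus the points mu_1, ..., mu_q. *)
- have [qn dE] : (q <= ntilde n)%N /\ d = q.
    have [Kout|[Kin [qn gt]]] := cas.
      split; first by have [] := hIII Kout.
      rewrite qE; apply: eq_in_count => z zs; rewrite rootQ//.
      have -> : z != K by apply: contraNneq Kout => zK; rewrite /K_in_union -zK zs.
      by [].
    split=> //; rewrite qE; apply: eq_in_count => z zs.
    by rewrite rootQ// (gt_eqF gt) orbF.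
  rewrite dE in balls; have {}balls := balls qn; split=> q0.
    split=> //; case: (q) q0 qn balls => // q' _ qn.
    by apply: disjoint_union_infinite; apply: posbin.
  by move: balls; rewrite q0 muln0 !subn0; exact: disjoint_union_of_points.
- have [Ks Ksh] : K \in sigma /\ K \in sigmah by have [/andP] := hIV Kin.
  (* In option IV b) [K] is a double zero in addition to the mu_i. *)
  have dE : d = q.+1.
    have -> : d = count (mem sigmah) sigma.
      by apply: eq_in_count => z zs; rewrite rootQ// NK eqxx orbT andbT.
    rewrite -size_filter -(count_predC (pred1 K)) count_uniq_mem ?filter_uniq//.
    rewrite mem_filter /= Ks Ksh add1n qE count_filter; congr S.
    by apply: eq_count => z; rewrite /= andbC.
  have bE : 'C(N - 2 * q - 3, n - q - 1) = 'C(N - 2 * q.+1 - 1, n - q.+1).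
    by congr ('C(_, _)); clear; lia.
  rewrite bE; rewrite dE in balls; split; last exact: balls.
  by apply: disjoint_union_infinite (balls qn); apply: posbin.
Qed.
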